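(* There is an absolute constant $\alpha<2$ such that, with ''small'' defined via this $\alpha$ and $M=2^{d-1}$, $$|\mathcal{F}^{\mathcal{E}}|\le (e+e^{-\Omega(d)})2^M,\quad |\mathcal{F}^{\mathcal{E}}_4|\ge (2\sqrt{e}-2-e^{-\Omega(d)})2^M,\quad |\mathcal{F}^{\mathcal{E}}_5|\ge (e-2\sqrt{e}+1-e^{-\Omega(d)})2^M,$$ where $\pm e^{-\Omega(d)}$ denotes a term bounded in absolute value by $e^{-cd}$ for some absolute constant $c>0$ and all sufficiently large $d$.
   Context: $Q_d$ is the Hamming cube on $V=\{0,1\}^d$ (adjacent iff differing in one coordinate); $\mathcal{E}$ is the set of vertices with an even number of ones. $\mathcal{A}$ is the set of all $f\colon V\to\mathbb{Z}$ with $|f(u)-f(v)|=1$ for adjacent $u,v$. A set $A\subseteq V$ is small if $|A|<\alpha^d$. $\mathcal{F}^{\mathcal{E}}=\{f\in\mathcal{A}: \mathcal{E}\setminus f^{-1}(0)\text{ is small}\}$ and $\mathcal{F}^{\mathcal{E}}_i=\{f\in\mathcal{F}^{\mathcal{E}}: |\{f(v):v\in V\}|=i\}$. *)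

(* Defs.v *)
From HB Require Import structures.
From mathcomp Require Import all_boot all_order all_algebra.
From mathcomp Require Import finmap.
From mathcomp Require Import all_classical all_reals all_analysis.

Set Implicit Arguments.
Unset Strict Implicit.
Unset Printing Implicit Defensive.

Import Order.TTheory GRing.Theory Num.Theory.
Import numFieldNormedType.Exports.

Local Open Scope classical_set_scope.
Local Open Scope ring_scope.

Definition cube (d : nat) : finType := {ffun 'I_d -> bool}.

Definition adjacent (d : nat) (u v : cube d) : bool :=
  #|[set i : 'I_d | u i != v i]%SET| == 1%N.

Definition even_vertices (d : nat) : {set cube d} :=
  [set v : cube d | ~~ odd #|[set i : 'I_d | v i]%SET|]%SET.

Definition unit_step (d : nat) : set {ffun cube d -> int} :=
  [set f : {ffun cube d -> int} |
    forall u v : cube d, adjacent u v -> `|f u - f v| = 1].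

Definition small (R : realType) (alpha : R) (d : nat) (S : {set cube d}) : Prop :=
  #|S|%:R < alpha ^+ d.

Definition zero_set (d : nat) (f : {ffun cube d -> int}) : {set cube d} :=
  [set v : cube d | f v == 0]%SET.

Definition range_size (d : nat) (f : {ffun cube d -> int}) : nat :=
  #|` [fset f v | v : cube d]%fset|%fset.

Definition F_even (R : realType) (alpha : R) (d : nat) :
    set {ffun cube d -> int} :=
  [set f : {ffun cube d -> int} |
    unit_step f /\ small alpha (even_vertices d :\: zero_set f)%SET].

Definition F_even_range (R : realType) (alpha : R) (d i : nat) :
    set {ffun cube d -> int} :=
  [set f : {ffun cube d -> int} | F_even alpha f /\ range_size f = i].

Arguments F_even {R} alpha d.
Arguments F_even_range {R} alpha d i.

(* [fset_set S] is empty when [S] is infinite, so an upper bound on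
   [set_card S] has content only together with [finite_set S]. *)
Definition set_card (T : choiceType) (S : set T) : nat :=
  #|` fset_set S|%fset.

(* [exp_small eps] says that [eps] is a term of the form +/- e^{-Omega(d)}. *)
Definition exp_small (R : realType) (eps : nat -> R) : Prop :=
  exists2 c : R, 0 < c & \forall d \near \oo, `|eps d| <= expR (- (c * d%:R)).

(* Main.v *)
(** Upper bound: a function f in F^E is encoded by its restriction g to the
    even vertices; once g is known, an odd vertex w has two possible values if
    g is constant on the neighbours of w and one otherwise, so f ranges over
    2^(M - rough g) functions.  Removing from the support of g the 2-linked
    component of a vertex v shows that the partition function Z of the weights
    2^(- rough g) satisfies Z(X) <= Z(X \ v) (1 + rho), where rho sums the
    weights of the polymers (2-linked supports) through v.  Single vertices
    contribute 2 * 2^-d, hence the factor e.  For larger polymers C, small sets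
    expand (n = |N(C)| >= 96 |C|), and it is enough to encode g in o(n) steps
    plus few choices: a greedy algorithm covers C by cells (the neighbours of
    one vertex lying in C, with a common height), and a walk of length
    O(n / sqrt d) through their centres records them.

    Lower bound: pairwise unlinked sets S of at most d even vertices, with
    heights +-2 on S and free signs on the odd vertices not adjacent to S; the
    number of such S is estimated by comparing the generating polynomial of the
    unlinked sets with (1 + y)^M at y = 2^-d and at y = 2 * 2^-d. *)

From mathcomp Require Import all_boot all_order all_algebra.
From mathcomp Require Import zify ring lra.
Require Import Defs.

Set Implicit Arguments.
Unset Strict Implicit.
Unset Printing Implicit Defensive.

(** * Flips and isoperimetry in the cube *)

Definition flip d (x : cube d) (i : 'I_d) : cube d :=
  [ffun j => x j (+) (j == i)].

Lemma flipK d (i : 'I_d) : involutive (fun x : cube d => flip x i).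
Proof. by move=> x; apply/ffunP => j; rewrite !ffunE addbK. Qed.

Lemma flip_inj d (i : 'I_d) : injective (fun x : cube d => flip x i).
Proof. exact: can_inj (flipK i). Qed.

Lemma flipC d (x : cube d) i j : flip (flip x i) j = flip (flip x j) i.
Proof. by apply/ffunP => k; rewrite !ffunE addbAC. Qed.

Lemma flip_dir_inj d (x : cube d) : injective (flip x).
Proof.
move=> i j /ffunP/(_ i); rewrite !ffunE eqxx.
by case: (i =P j) => // _; case: (x i).
Qed.

Lemma flip_moved d (x y : cube d) p i j :
  x p != y p -> flip x i = flip y j -> (i == p) || (j == p).
Proof.
move=> xy /ffunP/(_ p); rewrite !ffunE ![p == _]eq_sym.
by case: (i == p); case: (j == p) => //; rewrite !addbF => /eqP; rewrite (negPf xy).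
Qed.

Definition nbhd d (C : {set cube d}) : {set cube d} :=
  [set w | [exists i, flip w i \in C]].

Lemma mem_nbhd d (C : {set cube d}) x i : x \in C -> flip x i \in nbhd C.
Proof. by move=> xC; rewrite inE; apply/existsP; exists i; rewrite flipK. Qed.

(** Double counting of the edge ends at [U]; a vertex outside [nbhd C] sees nothing of [U] and adds
    0. *)
Lemma sum_nbhd d (C U : {set cube d}) : U \subset C ->
  \sum_(w in nbhd C) #|[set i | flip w i \in U]| = d * #|U|.
Proof.
move=> UC.
have -> : \sum_(w in nbhd C) #|[set i | flip w i \in U]| =
          \sum_w \sum_i (flip w i \in U : nat).
  rewrite big_mkcond /=; apply: eq_bigr => w _.
  have -> : \sum_i (flip w i \in U : nat) = #|[set i | flip w i \in U]|.
    by rewrite -sum1_card [RHS]big_mkcond /=; apply: eq_bigr => i _; rewrite inE; case: (_ \in _).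
  case: ifP => // wN; apply/esym/eqP; rewrite cards_eq0; apply/eqP/setP => i.
  rewrite in_set0 inE; apply: contraFF wN => wU; rewrite inE.
  by apply/existsP; exists i; apply: (subsetP UC).
rewrite exchange_big /= (eq_bigr (fun=> #|U|)) ?sum_nat_const ?card_ord // => i _.
rewrite (reindex_inj (@flip_inj d i)) /= -sum1_card [RHS]big_mkcond /=.
by apply: eq_bigr => x _; rewrite flipK; case: (_ \in _).
Qed.

(** Double counting: a vertex with all its neighbours in [C] absorbs [d] of the [d * #|C|] edge ends
    at [C]. *)
Lemma card_interior d (C : {set cube d}) : 0 < d ->
  #|[set w | [forall i, flip w i \in C]]| <= #|C|.
Proof.
move=> d_gt0; rewrite -(leq_pmul2l d_gt0) -(sum_nbhd (subxx C)).
rewrite mulnC -sum_nat_const /= big_mkcond [leqRHS]big_mkcond /=.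
apply: leq_sum => w _; case: ifP => //; rewrite inE => /forallP wC.
have -> : w \in nbhd C by rewrite inE; apply/existsP; exists (Ordinal d_gt0).
suff -> : [set i | flip w i \in C] = setT by rewrite cardsT card_ord.
by apply/setP => i; rewrite !inE wC.
Qed.

Lemma card_nbhd_ge d (C : {set cube d}) x : x \in C -> d <= #|nbhd C|.
Proof.
move=> xC; rewrite -[d in d <= _]card_ord -(card_codom (@flip_dir_inj d x)).
apply/subset_leq_card/subsetP => _ /codomP[i ->]; exact: mem_nbhd.
Qed.

(** Two distinct vertices have at most two common neighbours: if they differ at [p], such a
    neighbour is [flip x p] or [flip y p]. *)
Lemma card_nbhd_ge2 d (C : {set cube d}) x y : x \in C -> y \in C -> x != y ->
  d + d <= #|nbhd C| + 2.
Proof.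
move=> xC yC xy.
have [p xyp] : exists p, x p != y p.
  apply/existsP; apply: contraNT xy => /existsPn e.
  by apply/eqP/ffunP => p; apply/eqP/negPn.
pose S z := [set flip z i | i : 'I_d].
have cS z : #|S z| = d by rewrite card_imset ?card_ord //; exact: flip_dir_inj.
have -> : d + d = #|S x :|: S y| + #|S x :&: S y| by rewrite cardsUI !cS.
apply: leq_add.
  apply/subset_leq_card/subsetP => _ /setUP[] /imsetP[i _ ->]; exact: mem_nbhd.
apply: (@leq_trans #|[set flip x p; flip y p]|); last by rewrite cards2; case: (_ != _).
apply/subset_leq_card/subsetP => z /setIP[/imsetP[i _ ->] /imsetP[j _ e]].
rewrite !inE; case/orP: (flip_moved xyp e) => /eqP ep; first by rewrite ep eqxx.
by rewrite e ep eqxx orbT.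
Qed.

Lemma card_dir_edges d (U : {set cube d}) (i : 'I_d) b :
  #|[set x in U | flip x i \in U]| <= #|[set x in U | x i == b]|.*2.
Proof.
set Ub := [set x in U | x i == b].
have sub : [set x in U | flip x i \in U] \subset Ub :|: [set flip x i | x in Ub].
  apply/subsetP => x; rewrite !inE => /andP[xU fU].
  case: (x i =P b) => [_|/eqP xb]; rewrite ?xU //=.
  apply/imsetP; exists (flip x i); rewrite ?flipK // !inE fU /= ffunE eqxx.
  by clear Ub; move: xb; case: (x i); case: b.
apply: leq_trans (subset_leq_card sub) _; rewrite -addnn.
by apply: leq_trans (leq_card_setU _ _) _; rewrite leq_add2l leq_imset_card.
Qed.

(** Induction on the directions. When [U] is cut along [i], the smaller half has at most [2 ^ k.-1]
    vertices (none if [k = 0]), so its own bound improves by 2 per vertex; this pays for the edges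
    across the cut, bounded by [card_dir_edges]. *)
Lemma dir_edges_le d (s : seq 'I_d) : uniq s ->
  forall k (U : {set cube d}), #|U| <= 2 ^ k ->
  \sum_(j <- s) #|[set x in U | flip x j \in U]| <= k.*2 * #|U|.
Proof.
elim: s => [|i s IH] /=; first by move=> _ k U _; rewrite big_nil.
move=> /andP[nis us] k U Uk; rewrite big_cons.
pose V b := [set x in U | x i == b].
have cV b : #|U| = #|V b| + #|V (~~ b)|.
  rewrite -(cardsID [set x : cube d | x i == b] U); congr addn; apply: eq_card => x;
    rewrite !inE //.
  by rewrite andbC; congr andb; case: (x i); case: b.
have dV b : \sum_(j <- s) #|[set x in U | flip x j \in U]| =
   \sum_(j <- s) #|[set x in V b | flip x j \in V b]| +
   \sum_(j <- s) #|[set x in V (~~ b) | flip x j \in V (~~ b)]|.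
  rewrite -big_split /= big_seq [RHS]big_seq; apply: eq_bigr => j js.
  have ji : (i == j) = false by apply: contraNF nis => /eqP ->.
  rewrite -(cardsID [set x : cube d | x i == b] [set x in U | flip x j \in U]).
  congr addn; apply: eq_card => x; rewrite !inE !ffunE ji addbF.
    by case: (x \in U); case: (flip x j \in U); case: (x i == b).
  by case: (x \in U); case: (flip x j \in U); case: (x i); case: (b).
have [b Vb] : exists b, #|V (~~ b)| <= #|V b|.
  case: (leqP #|V (~~ true)| #|V true|) => [|/ltnW] h; first by exists true.
  by exists false.
have ei : #|[set x in U | flip x i \in U]| <= #|V (~~ b)|.*2 := card_dir_edges U i (~~ b).
rewrite (dV b) (cV b).
have {Uk} : #|V b| + #|V (~~ b)| <= 2 ^ k by rewrite -cV.
have := IH us k (V b); have := IH us k.-1 (V (~~ b)).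
move: ei Vb; move: #|[set x in U | _]| #|V b| #|V (~~ b)| (bigop _ _ _) (bigop _ _ _).
move=> e p q D1 D2; case: k => [|k] h1 h2 /= IH1 IH2 h; last by rewrite expnS in h IH2; nia.
by have := IH2 ltac:(lia); have := IH1 ltac:(lia); nia.
Qed.

Lemma edge_isoperimetry d k (U : {set cube d}) : #|U| <= 2 ^ k ->
  \sum_(x in U) #|[set i | flip x i \in U]| <= k.*2 * #|U|.
Proof.
move=> Uk; apply: leq_trans (dir_edges_le (enum_uniq 'I_d) Uk).
rewrite big_enum /= (eq_bigr (fun x => \sum_i (flip x i \in U : nat))); last first.
  by move=> x _; rewrite -sum1_card big_mkcond; apply: eq_bigr => i _; rewrite inE; case: (_ \in _).
rewrite exchange_big /=; apply: leq_sum => i _.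
rewrite -sum1_card big_mkcond [leqRHS]big_mkcond; apply: leq_sum => x _.
by rewrite inE; case: (x \in U).
Qed.

(** Otherwise [C :|: nbhd C] has at most [2 ^ k] vertices and contains all [d] edges at every vertex
    of [C], more than [edge_isoperimetry] allows. *)
Lemma nbhd_expansion d k K (C : {set cube d}) : K.+1 * k.*2 < d ->
  K.+1 * #|C| <= 2 ^ k -> K * #|C| <= #|nbhd C|.
Proof.
move=> Kd Ck; rewrite leqNgt; apply/negP => nK.
set U := C :|: nbhd C.
have cU : #|U| <= K.+1 * #|C|.
  by apply: leq_trans (leq_card_setU _ _) _; rewrite mulSn leq_add2l ltnW.
have C0 : 0 < #|C| by case: #|C| nK; rewrite ?muln0.
have := edge_isoperimetry (leq_trans cU Ck).
suff : d * #|C| <= \sum_(x in U) #|[set i | flip x i \in U]| by nia.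
rewrite mulnC -sum_nat_const big_mkcond [leqRHS]big_mkcond /=.
apply: leq_sum => x _; case: ifP => // xC; rewrite in_setU xC.
suff -> : [set i | flip x i \in U] = setT by rewrite cardsT card_ord.
by apply/setP => i; rewrite in_setT inE in_setU mem_nbhd // orbT.
Qed.

Import Order.TTheory GRing.Theory Num.Theory.

Lemma ler_sum_inj (R : realFieldType) (I J : finType) (P : pred I) (Q : pred J)
    (h : I -> J) (F : I -> R) (G : J -> R) :
  (forall j, Q j -> 0 <= G j)%R -> {in P &, injective h} ->
  (forall i, P i -> Q (h i) /\ F i <= G (h i))%R ->
  (\sum_(i | P i) F i <= \sum_(j | Q j) G j)%R.
Proof.
move=> G0 hI PQ.
apply: (@le_trans _ _ (\sum_(i | P i) G (h i))%R).
  by apply: ler_sum => i /PQ[].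
have -> : (\sum_(i | P i) G (h i) = \sum_(j in [set h i | i in P]) G j)%R.
  by rewrite big_imset.
rewrite [leLHS]big_mkcond [leRHS]big_mkcond; apply: ler_sum => j _.
case: ifP => [/imsetP[i Pi ->]|_]; first by rewrite (PQ i Pi).1.
by case: ifP => // /G0.
Qed.

(** * Polymers *)

(** Existence of a common neighbour: distance two, or equality through [i = j]. *)
Definition linked d (x y : cube d) := [exists i, [exists j, y == flip (flip x i) j]].

Lemma linked_sym d : symmetric (@linked d).
Proof.
suff s (x y : cube d) : linked x y -> linked y x by move=> x y; apply/idP/idP; apply: s.
case/existsP => i /existsP[j /eqP ->]; apply/existsP; exists j; apply/existsP; exists i.
by rewrite !flipK.
Qed.

Lemma linked_flip d (w : cube d) i j : linked (flip w i) (flip w j).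
Proof. by apply/existsP; exists i; apply/existsP; exists j; rewrite flipK. Qed.

(* For [v \in C]: [C] is connected through [linked], phrased as a cut condition. *)
Definition linked_from d (v : cube d) (C : {set cube d}) :=
  [forall A : {set cube d}, [&& v \in A, A \subset C & A != C] ==>
    [exists x in A, [exists y in C :\: A, linked x y]]].

(** How two values of a unit-step function around a common neighbour can differ: by 0 or 2. *)
Definition close_heights (a b : nat) := [|| a == b, a == b.+2 | b == a.+2].

Section Heights.
Variables (d q : nat) (z : 'I_q.+1).
Implicit Types (g : {ffun cube d -> 'I_q.+1}) (v w x y : cube d) (C X : {set cube d}).

(** [z] is the height that stands for the value 0 after the integers have been shifted into
    ['I_q.+1]. *)
Definition supp g : {set cube d} := [set x | g x != z].

Definition admissible g :=
  [forall w, [forall i, [forall j, close_heights (g (flip w i)) (g (flip w j))]]].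

(** At a flat odd vertex both the height above and the height below its neighbours remain possible;
    elsewhere the neighbours force the value. *)
Definition flat g w := [forall i, [forall j, g (flip w i) == g (flip w j)]].

Definition rough g : nat := #|[set w | ~~ flat g w]|.

Definition restrict C g : {ffun cube d -> 'I_q.+1} :=
  [ffun x => if x \in C then g x else z].

Definition component g v : {set cube d} :=
  [set x | connect (fun x y => [&& x \in supp g, y \in supp g & linked x y]) v x].

Lemma component_edge_sym g :
  connect_sym (fun x y => [&& x \in supp g, y \in supp g & linked x y]).
Proof. by apply: sym_connect_sym => x y; rewrite linked_sym andbCA. Qed.

Lemma mem_component g v : v \in component g v.
Proof. by rewrite inE connect0. Qed.

Lemma component_closed g v x y :
  x \in component g v -> x \in supp g -> y \in supp g -> linked x y -> y \in component g v.
Proof.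
rewrite !inE => vx xS yS xy; apply: connect_trans vx _; apply: connect1.
by rewrite xy !inE xS yS.
Qed.

Lemma component_sub g v : v \in supp g -> component g v \subset supp g.
Proof.
move=> vS; apply/subsetP => x; rewrite inE => vx.
have cl : closed (fun x y => [&& x \in supp g, y \in supp g & linked x y]) (mem (supp g)).
  by move=> a b /and3P[/= -> -> _].
by have := closed_connect cl vx; rewrite /= vS => <-.
Qed.

Lemma component_linked g v : v \in supp g -> linked_from v (component g v).
Proof.
move=> vS; apply/forallP => A; apply/implyP => /and3P[vA AC]; apply: contraNT => noedge.
rewrite eqEsubset AC /=; apply/subsetP => x; rewrite inE => vx.
have cl : closed (fun x y => [&& x \in supp g, y \in supp g & linked x y]) (mem A).
  apply: intro_closed => [|a b]; first exact: component_edge_sym.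
  move=> /and3P[aS bS ab] /= aA; apply: contraNT noedge => bA.
  apply/existsP; exists a; rewrite aA; apply/existsP; exists b.
  by rewrite in_setD bA ab (component_closed (subsetP AC _ aA)).
by have := closed_connect cl vx; rewrite /= vA => <-.
Qed.

Section Split.
Variables (g : {ffun cube d -> 'I_q.+1}) (v : cube d).
Hypothesis vS : v \in supp g.
Let C := component g v.

Lemma supp_restrict_component : supp (restrict C g) = C.
Proof.
apply/setP => x; rewrite inE ffunE; have [xC|] := boolP (x \in C); last by rewrite eqxx.
by have := subsetP (component_sub vS) _ xC; rewrite inE.
Qed.

Lemma supp_restrictC : supp (restrict (~: C) g) = supp g :\: C.
Proof.
apply/setP => x; rewrite inE ffunE in_setC in_setD [x \in supp g]inE.
by case: (x \in C); rewrite ?eqxx.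
Qed.

(** The neighbours of [w] are pairwise linked, so once one of them lies in the component, all those
    in the support do. Every [w] sees either the component or the rest, never both. *)
Lemma restrict_dichotomy w :
  (forall i, restrict C g (flip w i) = g (flip w i) /\ restrict (~: C) g (flip w i) = z) \/
  (forall i, restrict C g (flip w i) = z /\ restrict (~: C) g (flip w i) = g (flip w i)).
Proof.
have [/existsP[i iC]|/existsPn noC] := boolP [exists i, flip w i \in C]; [left|right] => j.
  rewrite !ffunE in_setC; have [//|jC] := boolP (flip w j \in C) => /=.
  suff -> : g (flip w j) = z by [].
  apply/eqP; apply: contraNT jC => jS.
  apply: (component_closed iC); rewrite ?linked_flip ?inE //.
  by have := subsetP (component_sub vS) _ iC; rewrite inE.
by rewrite !ffunE in_setC (negPf (noC j)).
Qed.

Lemma admissible_restrict : admissible g ->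
  admissible (restrict C g) /\ admissible (restrict (~: C) g).
Proof.
move=> /forallP adm; split; apply/forallP => w; apply/forallP => i; apply/forallP => j;
  have /forallP/(_ i)/forallP/(_ j) := adm w; rewrite /close_heights;
  by case: (restrict_dichotomy w) => h;
    rewrite ?(h i).1 ?(h i).2 ?(h j).1 ?(h j).2 ?eqxx.
Qed.

Lemma rough_restrict : rough g = rough (restrict C g) + rough (restrict (~: C) g).
Proof.
rewrite /rough -cardsUI; set I := _ :&: _.
have -> : I = set0.
  apply/setP => w; rewrite !inE; apply/negP => /andP[].
  case: (restrict_dichotomy w) => h => [_ /negP[]|/negP[]];
  by apply/forallP => i; apply/forallP => j; case: (h i) => A B; case: (h j) => A' B';
    rewrite ?A ?A' ?B ?B'.
rewrite cards0 addn0; apply: eq_card => w; rewrite !inE -negb_and; congr negb.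
case: (restrict_dichotomy w) => h.
  have -> : flat (restrict (~: C) g) w.
    by apply/forallP => i; apply/forallP => j; rewrite (h i).2 (h j).2.
  by rewrite andbT; apply: eq_forallb => i; apply: eq_forallb => j; rewrite (h i).1 (h j).1.
have -> : flat (restrict C g) w.
  by apply/forallP => i; apply/forallP => j; rewrite (h i).1 (h j).1.
by rewrite andTb; apply: eq_forallb => i; apply: eq_forallb => j; rewrite (h i).2 (h j).2.
Qed.

End Split.

Variables (R : realFieldType) (k : nat).

Definition weight g : R := (2^-1 ^+ rough g)%R.

Lemma weight_ge0 g : (0 <= weight g)%R.
Proof. by rewrite exprn_ge0 ?invr_ge0. Qed.

Definition partition_function X : R :=
  (\sum_(g | [&& admissible g, supp g \subset X & (#|supp g| <= k)%N]) weight g)%R.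

Definition polymer v g :=
  [&& admissible g, v \in supp g, linked_from v (supp g) & #|supp g| <= k].

(* Split g into its component at v and the rest: every vertex sees only one of the two,
   so the weights multiply. *)
Lemma partition_function_step X v : v \in X ->
  (partition_function X <=
   partition_function (X :\ v) * (1 + \sum_(g | polymer v g) weight g))%R.
Proof.
move=> vX; rewrite /partition_function (bigID (fun g => v \in supp g)) /= addrC mulrDr mulr1.
apply: lerD.
  rewrite le_eqVlt; apply/orP; left; apply/eqP/eq_bigl => g.
  by rewrite subsetD1; case: (v \in supp g); rewrite ?andbF ?andbT //= ?andbF.
rewrite mulrC big_distrlr /= pair_big /=.
apply: (ler_sum_inj (h := fun g => (restrict (component g v) g, restrict (~: component g v) g))).
- by move=> p _; rewrite mulr_ge0 ?weight_ge0.
- move=> g1 g2 /andP[_ v1] /andP[_ v2] [/= e1 e2].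
  have eC : component g1 v = component g2 v.
    by rewrite -(supp_restrict_component v1) -(supp_restrict_component v2) e1.
  apply/ffunP => x.
  move: (congr1 (fun f : {ffun _ -> _} => f x) e1) (congr1 (fun f : {ffun _ -> _} => f x) e2).
  by rewrite !ffunE !in_setC eC; case: (x \in _).
move=> g /andP[/and3P[adm sX sk] vS]; have [a1 a2] := admissible_restrict vS adm.
split; last by rewrite /weight (rough_restrict vS) exprD.
rewrite /polymer a1 a2 supp_restrict_component // mem_component component_linked //=.
rewrite (leq_trans (subset_leq_card (component_sub vS))) //=.
rewrite supp_restrictC; apply/andP; split.
  rewrite subsetD1 !inE connect0 andbT.
  by rewrite (subset_trans (subsetDl _ _)).
by rewrite (leq_trans (subset_leq_card (subsetDl _ _))).
Qed.

(** Remove the vertices of [X] one at a time; over the empty set only the constant [z] remains, of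
    weight at most 1. *)
Lemma partition_function_le X (rho : R) : (0 <= rho)%R ->
  (forall v, v \in X -> \sum_(g | polymer v g) weight g <= rho)%R ->
  (partition_function X <= (1 + rho) ^+ #|X|)%R.
Proof.
move=> rho0; have [n] := ubnP #|X|; elim: n X => // n IH X Xn Xrho.
have [->|[v vX]] := set_0Vmem X.
  rewrite cards0 expr0 /partition_function (big_pred1 [ffun=> z]) => [|g] /=.
    by rewrite exprn_ile1 ?invr_ge0 // invf_le1 ?ler1n.
  apply/idP/eqP => [/and3P[_ /subsetP s0 _]|->].
    by apply/ffunP => x; rewrite ffunE; apply/eqP/negPn/negP => gx; have := s0 x;
      rewrite !inE => /(_ gx).
  have -> : supp [ffun=> z] = set0 by apply/setP => x; rewrite !inE ffunE eqxx.
  rewrite sub0set cards0 andbT.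
  by apply/forallP => w; apply/forallP => i; apply/forallP => j; rewrite !ffunE /close_heights eqxx.
apply: le_trans (partition_function_step vX) _.
rewrite (cardsD1 v) vX exprSr; apply: ler_pM.
- by apply: sumr_ge0 => g _; exact: weight_ge0.
- by rewrite addr_ge0 // sumr_ge0 // => g _; exact: weight_ge0.
- apply: IH => [|w /setD1P[_ wX]]; last exact: Xrho.
  by move: Xn; rewrite (cardsD1 v X) vX.
by rewrite lerD2l Xrho.
Qed.

End Heights.

(** * Greedy cells and walk codes *)

Lemma bin_le_exp2 n m : 'C(n, m) <= 2 ^ n.
Proof.
have [nm|nm] := ltnP n m; first by rewrite bin_small.
rewrite -[2]/(1 + 1) expnDn (bigD1 (inord m)) //= inordK ?ltnS //.
by rewrite !exp1n !muln1 leq_addr.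
Qed.

(** [s ^ s] is at most [(s + 1) ... (2 * s)], which is ['C(s + s, s) * s!]. *)
Lemma expn_self_le s : s ^ s <= 4 ^ s * s`!.
Proof.
apply: (@leq_trans ('C(s + s, s) * s`!)); last first.
  rewrite leq_mul2r -[4]/(2 ^ 2) -expnM mul2n -addnn; apply/orP; right; exact: bin_le_exp2.
rewrite bin_ffact ffact_prod -[X in _ ^ X]card_ord -prod_nat_const.
by apply: leq_prod => i _; have := ltn_ord i; lia.
Qed.

Lemma ffact_le_expn n m : n ^_ m <= n ^ m.
Proof.
rewrite ffact_prod -[X in _ ^ X]card_ord -prod_nat_const.
by apply: leq_prod => i _; rewrite leq_subr.
Qed.

(** Cost of one greedy step that removes [s] of [u] uncovered vertices. The quotient of factorials
    is at most [u ^ s], the binomial at most [d ^ s / s!], and [d * u <= 2 * n * s] combines with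
    [expn_self_le]. The form telescopes over the steps. *)
Lemma bin_fact_le d n u s : s <= u -> d * u <= n.*2 * s ->
  'C(d, s) * u`! <= (8 * n) ^ s * (u - s)`!.
Proof.
move=> su h; rewrite -(ffact_fact su) mulnA leq_mul2r; apply/orP; right.
rewrite -(leq_pmul2r (fact_gt0 s)) mulnAC bin_ffact.
apply: (@leq_trans ((d * u) ^ s)).
  by rewrite expnMn leq_mul // ffact_le_expn.
apply: (@leq_trans ((n.*2 * s) ^ s)); first by case: s su h => [|s] su h; rewrite ?expn0 ?leq_exp2r.
rewrite expnMn; apply: leq_trans (leq_mul (leqnn _) (expn_self_le s)) _.
by rewrite mulnA -expnMn -muln2 -mulnA [8 * n]mulnC.
Qed.

(** Three distinct heights cannot differ pairwise by exactly 2, so at most two heights occur around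
    a vertex. *)
Lemma close_heights3 a b c : close_heights a b -> close_heights a c -> close_heights b c ->
  [|| a == b, a == c | b == c].
Proof. by rewrite /close_heights; lia. Qed.

Section Greedy.
Variables (d q : nat) (z : 'I_q.+1) (g : {ffun cube d -> 'I_q.+1}).
Hypotheses (d_gt0 : 0 < d) (adm : admissible g).
Let n := #|nbhd (supp z g)|.

Definition monochromatic (c : cube d * {set 'I_d}) :=
  [forall i in c.2, [forall j in c.2, g (flip c.1 i) == g (flip c.1 j)]].

(** Averaging over the [n] vertices of the neighbourhood yields a [w] with at least [d * #|U| / n]
    neighbours in [U]; these carry at most two heights, and the more frequent one keeps half of
    them. *)
Lemma large_cell (U : {set cube d}) : U \subset supp z g -> U != set0 ->
  exists w, exists A : {set 'I_d}, [/\ A != set0, [forall i in A, flip w i \in U],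
    monochromatic (w, A) & d * #|U| <= n.*2 * #|A|].
Proof.
move=> US U0.
have dU : 0 < d * #|U| by rewrite muln_gt0 d_gt0 card_gt0.
pose deg w := #|[set i | flip w i \in U]|.
have [w hw] : exists w, d * #|U| <= n * deg w.
  have [/existsP[w]|/existsPn no] := boolP [exists w, d * #|U| <= n * deg w]; first by exists w.
  have n0 : 0 < n by case: (posnP n) => // e; have := sum_nbhd US;
    rewrite big1 ?(cards0_eq e) => [|w]; rewrite ?inE //; lia.
  have : n * (d * #|U|) = \sum_(w in nbhd (supp z g)) n * deg w by rewrite -big_distrr /= sum_nbhd.
  have : \sum_(w in nbhd (supp z g)) (n * deg w).+1 <= n * (d * #|U|).
    by rewrite -sum_nat_const; apply: leq_sum => w _; rewrite ltnNge no.
  rewrite (eq_bigr (fun w => n * deg w + 1)) => [|w _]; last by rewrite addn1.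
  by rewrite big_split /= sum1_card -/n; lia.
pose B := [set i | flip w i \in U].
have [i iB] : exists i, i \in B.
  by apply/set0Pn; rewrite -card_gt0; move: hw dU; rewrite /deg -/B; case: #|B|; lia.
pose A a := [set j in B | g (flip w j) == a].
have AU a : [forall j in A a, flip w j \in U].
  by apply/forallP => j; apply/implyP; rewrite !inE => /andP[].
have mA a : monochromatic (w, A a).
  apply/forallP => j; apply/implyP; rewrite inE => /andP[_ /eqP ->].
  by apply/forallP => l; apply/implyP; rewrite inE => /andP[_ /eqP ->].
have good a : A a != set0 -> #|B| <= #|A a|.*2 ->
  exists w A, [/\ A != set0, [forall i in A, flip w i \in U], monochromatic (w, A) & d * #|U| <=
    n.*2 * #|A|].
  by move=> A0 BA; exists w, (A a); split=> //; move: hw; rewrite /deg -/B; nia.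
have [h|h] := leqP #|B| #|A (g (flip w i))|.*2.
  by apply: (good _ _ h); apply/set0Pn; exists i; rewrite inE iB eqxx.
have [j jB ji] : exists2 j, j \in B & g (flip w j) != g (flip w i).
  apply/exists_inP; apply: contraTT h; rewrite negb_exists_in -leqNgt => /forall_inP all_i.
  apply: (@leq_trans #|A (g (flip w i))|); last by rewrite -addnn leq_addr.
  by apply/subset_leq_card/subsetP => j jB; rewrite inE jB -[_ == _]negbK all_i.
apply: (good (g (flip w j))).
  by apply/set0Pn; exists j; rewrite inE jB eqxx.
have : #|B| <= #|A (g (flip w i))| + #|A (g (flip w j))|; last by lia.
apply: leq_trans (leq_card_setU _ _).
apply/subset_leq_card/subsetP => l lB; rewrite !inE; rewrite inE in lB; rewrite lB /=.
have cl a b : close_heights (g (flip w a)) (g (flip w b)).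
  by have /forallP/(_ w)/forallP/(_ a)/forallP/(_ b) := adm.
have := close_heights3 (cl l i) (cl l j) (cl i j).
rewrite -!val_eqE /=; case/or3P => [->|->|e] //; first by rewrite orbT.
by move: ji; rewrite -val_eqE /= eq_sym e.
Qed.

(** Remove a large cell repeatedly. The product bound telescopes through [bin_fact_le]; the last
    bound says that only about [sqrt (n * #|U| / d)] cells are used. *)
Lemma greedy_cells (U : {set cube d}) : U \subset supp z g ->
  exists s : seq (cube d * {set 'I_d}),
  [/\ all (fun c => monochromatic c && [forall i in c.2, flip c.1 i \in U]) s,
      (forall x, x \in U -> exists2 c, c \in s & [exists i in c.2, flip c.1 i == x]),
      \prod_(c <- s) 'C(d, #|c.2|) * #|U|`! <= (8 * n) ^ #|U| &
      size s ^ 2 * d <= 16 * n * #|U|].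
Proof.
have [m] := ubnP #|U|; elim: m U => // m IH U Um US.
have [->|U0] := eqVneq U set0.
  exists [::]; split=> // [x|]; first by rewrite inE.
  by rewrite big_nil cards0.
have [w [A [A0 AU mono hA]]] := large_cell US U0.
pose V := [set flip w i | i in A].
have cV : #|V| = #|A| by rewrite card_imset //; exact: flip_dir_inj.
have VU : V \subset U by apply/subsetP => _ /imsetP[i iA ->]; exact: (forall_inP AU).
have cUV : #|U :\: V| = #|U| - #|A| by rewrite cardsD (setIidPr VU) cV.
have AU' : #|A| <= #|U| by rewrite -cV subset_leq_card.
have A_gt0 : 0 < #|A| by rewrite card_gt0.
have [||s [s1 s2 s3 s4]] := IH (U :\: V); first by rewrite cUV; lia.
  by rewrite (subset_trans (subsetDl _ _)).
exists ((w, A) :: s); split.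
- rewrite /= mono AU /=; apply: sub_all s1 => c /andP[-> /forall_inP h] /=.
  by apply/forall_inP => i /h; rewrite inE => /andP[].
- move=> x xU; have [/imsetP[i iA ->]|xV] := boolP (x \in V).
    by exists (w, A); rewrite ?mem_head //; apply/exists_inP; exists i.
  have [|c cs cx] := s2 x; first by rewrite inE xV.
  by exists c; rewrite // inE cs orbT.
- rewrite big_cons /= mulnAC.
  apply: leq_trans (leq_mul (bin_fact_le AU' hA) (leqnn _)) _.
  rewrite cUV in s3; rewrite -mulnA [_ `! * _]mulnC -[in leqRHS](subnKC AU') expnD.
  by rewrite leq_mul2l s3 orbT.
have dn : d <= n.
  by have /set0Pn[x /(subsetP US) xS] := U0; exact: card_nbhd_ge xS.
rewrite /= cUV in s4 *; set t := size s in s4 *.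
have dt : t ^ 2 * d <= 16 * n * #|U| by apply: leq_trans s4 _; rewrite leq_mul2l leq_subr orbT.
(* Squaring: [t ^ 2 * d * d <= 16 * n * #|U| * d <= 32 * n ^ 2 * #|A|], below [(6 * n * #|A|) ^ 2].
   Passing from [t] to [t + 1] cells then costs [2 * t * d + d <= 13 * n * #|A|], within the
   available 16. *)
have : t * d <= 6 * n * #|A|.
  rewrite -(@leq_exp2r _ _ 2) // expnMn -[d ^ 2]/(d * d) mulnA.
  apply: leq_trans (leq_mul dt (leqnn d)) _.
  rewrite -mulnA [#|U| * d]mulnC; apply: leq_trans (leq_mul (leqnn _) hA) _.
  rewrite -muln2 !expnMn -!mulnn.
  have : n * n * #|A| <= n * n * (#|A| * #|A|) by rewrite leq_mul2l leq_pmulr ?orbT.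
  lia.
rewrite -mulnn in s4 *.
have : n <= n * #|A| by rewrite leq_pmulr.
have -> : 16 * n * #|U| = 16 * n * (#|U| - #|A|) + 16 * (n * #|A|).
  by rewrite -[#|U| in LHS](subnK AU') mulnDr; lia.
lia.
Qed.

End Greedy.

Section Codes.
Variables (d q : nat) (z : 'I_q.+1).

(* A letter moves the walker (or not) and then assigns a height to some of
   the neighbours of the new position. *)
Definition letter : finType := (option 'I_d * 'I_q.+1 * {set 'I_d})%type.

Definition step (p : cube d) (o : option 'I_d) : cube d :=
  if o is Some i then flip p i else p.

Fixpoint marks (p : cube d) (s : seq letter) : seq (cube d * 'I_q.+1 * {set 'I_d}) :=
  if s is l :: s' then (step p l.1.1, l.1.2, l.2) :: marks (step p l.1.1) s' else [::].

Definition walk_end (p : cube d) (s : seq letter) := foldl step p [seq l.1.1 | l <- s].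

Definition idle (o : option 'I_d) : letter := (o, ord0, set0).

Definition choices (l : letter) := 'C(d, #|l.2|).

Lemma marks_cat p s1 s2 : marks p (s1 ++ s2) = marks p s1 ++ marks (walk_end p s1) s2.
Proof. by elim: s1 p => //= l s1 IH p; rewrite IH. Qed.

Lemma mem_marks p s m : m \in marks p s ->
  exists s1 s2, s = s1 ++ s2 /\ walk_end p s1 = m.1.1.
Proof.
elim: s p => //= l s IH p; rewrite in_cons => /orP[/eqP ->|/IH[s1 [s2 [-> e]]]].
  by exists [:: l], s.
by exists (l :: s1), s2.
Qed.

Lemma walk_end_idle p r : walk_end p (map idle r) = foldl step p r.
Proof. by rewrite /walk_end -map_comp map_id_in. Qed.

Lemma marks_idle p r m : m \in marks p (map idle r) -> m.2 = set0.
Proof. by elim: r p => //= o r IH p; rewrite in_cons => /orP[/eqP ->|/IH]. Qed.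

Lemma choices_idle r : \prod_(l <- map idle r) choices l = 1.
Proof. by rewrite big_map big1 // => o _; rewrite /choices cards0 bin0. Qed.

(* Flips commute, so repeating a sequence of flips undoes it. *)
Lemma foldl_step_twice p r : foldl step (foldl step p r) r = p.
Proof.
have C o r' x : foldl step (step x o) r' = step (foldl step x r') o.
  elim: r' x => //= o' r' IH x; rewrite -IH; congr foldl.
  by case: o {IH} o' => [i|] [j|] //=; rewrite flipC.
elim: r p => //= o r IH p; rewrite C IH.
by case: o => //= i; rewrite flipK.
Qed.

(** Interrupt the walk where it stands at the centre of [m], follow [r] to [w], record the cell, and
    return by repeating [r]. Idle letters record the empty set, so they have one choice and assert
    nothing about heights. *)
Lemma insert_cell p s m r w a (A : {set 'I_d}) : m \in marks p s -> foldl step m.1.1 r = w ->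
  exists s', [/\ size s' = size s + (size r).*2.+1,
    \prod_(l <- s') choices l = \prod_(l <- s) choices l * 'C(d, #|A|),
    {subset (w, a, A) :: marks p s <= marks p s'} &
    forall m', m' \in marks p s' -> m' \in (w, a, A) :: marks p s \/ m'.2 = set0].
Proof.
move=> /mem_marks[s1 [s2 [-> <-]]] rw.
exists (s1 ++ (map idle r ++ (None, a, A) :: map idle r) ++ s2).
have eD : marks p (s1 ++ (map idle r ++ (None, a, A) :: map idle r) ++ s2) =
    marks p s1 ++ (marks (walk_end p s1) (map idle r) ++
      (w, a, A) :: marks w (map idle r)) ++ marks (walk_end p s1) s2.
  rewrite !marks_cat /= walk_end_idle rw; congr (_ ++ (_ ++ marks _ _)).
  by rewrite /walk_end !map_cat !foldl_cat /= -!map_comp !map_id_in // rw -rw foldl_step_twice.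
split.
- by rewrite !size_cat /= !size_map -addnn; lia.
- rewrite !big_cat big_cons /= !choices_idle /choices /=; lia.
- rewrite eD marks_cat => m'; rewrite in_cons !mem_cat in_cons.
  by case: (m' == _) => /=; rewrite ?orbT // => /orP[->|->]; rewrite ?orbT.
rewrite eD marks_cat => m'; rewrite !mem_cat !in_cons mem_cat.
case/or3P => [->|/or3P[/marks_idle|->|/marks_idle]|->]; rewrite ?orbT; auto.
Qed.

Variable g : {ffun cube d -> 'I_q.+1}.

Definition sound_mark (m : cube d * 'I_q.+1 * {set 'I_d}) :=
  [forall i in m.2, (flip m.1.1 i \in supp z g) && (g (flip m.1.1 i) == m.1.2)].

Definition covers (m : cube d * 'I_q.+1 * {set 'I_d}) x := [exists i in m.2, flip m.1.1 i == x].

Definition encodes v s :=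
  all sound_mark (marks v s) && [forall x in supp z g, has (covers^~ x) (marks v s)].

Lemma sound_empty_mark m : m.2 = set0 -> sound_mark m.
Proof. by move=> e; apply/forall_inP => i; rewrite e inE. Qed.

Lemma linked_cells_path x y w w' (i j : 'I_d) : linked x y -> flip w i = x -> flip w' j = y ->
  exists2 r, size r = 4 & foldl step w r = w'.
Proof.
case/existsP => a /existsP[b /eqP ->] <- e.
exists [:: Some i; Some a; Some b; Some j] => //=.
by rewrite -e flipK.
Qed.

(** The recorded vertices are grown from [v]: while some of the support is missing, connectedness
    supplies an unrecorded vertex linked to a recorded one, and its cell is reached by a short
    detour. *)
Lemma walk_through_cells v (s : seq (cube d * {set 'I_d})) : linked_from v (supp z g) ->
  v \in supp z g ->
  all (fun c => monochromatic g c && [forall i in c.2, flip c.1 i \in supp z g]) s ->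
  (forall x, x \in supp z g -> exists2 c, c \in s & [exists i in c.2, flip c.1 i == x]) ->
  exists l, [/\ encodes v l, size l <= (9 * size s).+1 &
    \prod_(x <- l) choices x <= \prod_(c <- s) 'C(d, #|c.2|)].
Proof.
move=> link vS /allP sS scov.
have mark_of c : c \in s -> exists a, sound_mark (c.1, a, c.2).
  move=> /sS /andP[/forall_inP mono /forall_inP cS].
  have [c0|[i ic]] := set_0Vmem c.2; first by exists ord0; apply: sound_empty_mark.
  exists (g (flip c.1 i)); apply/forall_inP => j jc; rewrite cS //=.
  by have /forall_inP := mono _ jc; apply.
have bin1 (c : cube d * {set 'I_d}) : 0 < 'C(d, #|c.2|).
  by rewrite bin_gt0 -[X in _ <= X]card_ord max_card.
(* Invariant: [r] holds the cells still to be recorded, everything recorded is correct, and either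
   [v] is already covered or the walk visits [v]. *)
suff grow k : forall r l, size r <= k -> {subset r <= s} ->
    (forall c, c \in s -> c \in r \/ exists a, (c.1, a, c.2) \in marks v l) ->
    all sound_mark (marks v l) ->
    (v \in [set x | has (covers^~ x) (marks v l)] \/
       exists2 m, m \in marks v l & m.1.1 = v) ->
    exists l', [/\ encodes v l', size l' <= size l + 9 * size r &
      \prod_(x <- l') choices x <= \prod_(x <- l) choices x * \prod_(c <- r) 'C(d, #|c.2|)].
  (* The initial idle letter makes the walk visit [v]; it is the [.+1] in the length. *)
  have [|||||l [l1 l2 l3]] := grow (size s) s [:: idle None]; rewrite //=.
  - by move=> c; left.
  - by rewrite sound_empty_mark.
  - by right; exists (v, ord0, set0); rewrite ?mem_head.
  exists l; split=> //; apply: leq_trans l3 _.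
  by rewrite (choices_idle [:: None]) mul1n.
elim: k => [|k IH] r l rk rs cells sound start.
  exists l; move: rk; rewrite leqn0 size_eq0 => /eqP r0; rewrite r0 in cells *.
  split; rewrite ?big_nil ?muln1 ?leq_addr //; rewrite /encodes sound /=.
  apply/forall_inP => x /scov[c cs cx]; case: (cells _ cs) => // -[a ca].
  by apply/hasP; exists (c.1, a, c.2).
pose A := [set x | has (covers^~ x) (marks v l)].
have AS : A \subset supp z g.
  apply/subsetP => x; rewrite inE => /hasP[m ml /exists_inP[i im /eqP <-]].
  by have /forall_inP/(_ i im)/andP[] := allP sound _ ml.
have [AE|AE] := eqVneq A (supp z g).
  exists l; split; rewrite ?leq_addr //.
    rewrite /encodes sound /=; apply/forall_inP => x; rewrite -AE inE //.
  by rewrite leq_pmulr // prodn_gt0.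
(* Four moves out, one record and four moves back: nine letters per cell. *)
have extend m r4 c : m \in marks v l -> size r4 = 4 -> foldl step m.1.1 r4 = c.1 ->
   c \in r -> (exists2 i, i \in c.2 & (flip c.1 i == v) || (v \in A)) ->
     exists l', [/\ encodes v l', size l' <= size l + 9 * size r &
      \prod_(x <- l') choices x <= \prod_(x <- l) choices x * \prod_(c <- r) 'C(d, #|c.2|)].
  move=> ml r4s r4c cr vcov; have [a sa] := mark_of c (rs _ cr).
  have [l' [l1 l2 l3 l4]] := insert_cell a c.2 ml r4c.
  have [|||||l'' [e1 e2 e3]] := IH (rem c r) l'.
  - by rewrite size_rem //; case: (size r) rk.
  - by move=> x /mem_rem /rs.
  - move=> x xs; have [->|xc] := eqVneq x c; first by right; exists a; rewrite l3 ?mem_head.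
    case: (cells x xs) => [xr|[b xb]]; last by right; exists b; rewrite l3 // in_cons xb orbT.
    left; move: xr; rewrite (perm_mem (perm_to_rem cr)) in_cons (negPf xc) //.
  - apply/allP => m' /l4[|/sound_empty_mark//]; rewrite in_cons => /orP[/eqP ->|/(allP sound)] //.
  - left; rewrite inE; apply/hasP; case: vcov => i ic /orP[fv|].
      by exists (c.1, a, c.2); rewrite ?l3 ?mem_head //; apply/exists_inP; exists i.
    by rewrite inE => /hasP[m' m'l vm']; exists m'; rewrite // l3 // in_cons m'l orbT.
  exists l''; split=> //.
    apply: leq_trans e2 _; rewrite l1 r4s size_rem //.
    by have : 0 < size r by [case: (r) cr]; lia.
  apply: leq_trans e3 _; rewrite l2 (perm_big _ (perm_to_rem cr)) big_cons /=.
  by rewrite mulnA.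
have [vA|vA] := boolP (v \in A).
  (* The covered set is a proper part of the support containing [v], so the cut condition of
     [linked_from] gives a linked pair across it. *)
  have : [exists x in A, [exists y in supp z g :\: A, linked x y]].
    by have /forallP/(_ A)/implyP := link; apply; rewrite vA AS AE.
  case/exists_inP => x; rewrite inE => /hasP[m ml /exists_inP[i im /eqP ix]].
  case/exists_inP => y /setDP[/scov[c cs /exists_inP[j jc /eqP jy]] yA] xy.
  have [r4 r4s r4c] := linked_cells_path xy ix jy.
  apply: (extend m r4 c) => //; last by exists j; rewrite ?vA ?orbT.
  case: (cells c cs) => // -[a ca]; case/negP: yA; rewrite inE.
  by apply/hasP; exists (c.1, a, c.2) => //; apply/exists_inP; exists j; rewrite ?jy.
case: start => [|[m ml mv]]; first by rewrite (negPf vA).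
have [c cs /exists_inP[j jc /eqP jv]] := scov _ vS.
(* The first cell contains [v], so its centre is one flip away; the path is padded to length
   four. *)
apply: (extend m [:: Some j; None; None; None] c) => //=; rewrite ?mv -?jv ?flipK //.
  case: (cells c cs) => // -[a ca]; case/negP: vA; rewrite inE.
  by apply/hasP; exists (c.1, a, c.2) => //; apply/exists_inP; exists j; rewrite ?jv.
by exists j; rewrite ?eqxx.
Qed.

Lemma encodes_pad v l r : encodes v l -> encodes v (l ++ map idle r).
Proof.
case/andP => sl /forall_inP cl; apply/andP; split.
  rewrite marks_cat all_cat sl /=; apply/allP => m /marks_idle; exact: sound_empty_mark.
by apply/forall_inP => x /cl; rewrite marks_cat has_cat => ->.
Qed.

End Codes.

Section CodeSum.
Variables (d q : nat) (z : 'I_q.+1) (R : realFieldType).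
Implicit Type g : {ffun cube d -> 'I_q.+1}.

(** Marks are sound for both functions and cover both supports, so they fix every height different
    from [z]. *)
Lemma encodes_inj g g' v l : encodes z g v l -> encodes z g' v l -> g = g'.
Proof.
have half g1 g2 x : encodes z g1 v l -> encodes z g2 v l -> x \in supp z g1 -> g1 x = g2 x.
  move=> /andP[/allP s1 /forall_inP c1] /andP[/allP s2 _] /c1 /hasP[m ml /exists_inP[i im /eqP <-]].
  have /forall_inP/(_ i im)/andP[_ /eqP ->] := s1 _ ml.
  by have /forall_inP/(_ i im)/andP[_ /eqP ->] := s2 _ ml.
move=> e e'; apply/ffunP => x.
have [|xg] := boolP (x \in supp z g); first exact: half.
have [xg'|] := boolP (x \in supp z g'); first by rewrite (half _ _ _ e' e xg').
by move: xg; rewrite !inE !negbK => /eqP -> /eqP ->.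
Qed.

(** The sets of one size have total weight 1, so the [d.+1] sizes contribute [d.+1]; the other
    factor counts moves and heights. *)
Lemma sum_inv_choices :
  (\sum_(l : letter d q) ((choices l)%:R^-1 : R) = ((d.+1 * q.+1) * d.+1)%:R)%R.
Proof.
have e : (\sum_(A : {set 'I_d}) (('C(d, #|A|))%:R^-1 : R) = d.+1%:R)%R.
  rewrite (partition_big (fun A : {set 'I_d} => inord #|A| : 'I_d.+1) xpredT) //=.
  rewrite (eq_bigr (fun=> 1%R)) ?sumr_const ?card_ord // => i _.
  have cA (A : {set 'I_d}) : #|A| < d.+1 by rewrite ltnS -[X in _ <= X]card_ord max_card.
  rewrite (eq_bigl (fun A : {set 'I_d} => #|A| == i)) => [|A]; last first.
    by rewrite -val_eqE /= inordK.
  rewrite (eq_bigr (fun=> ('C(d, i))%:R^-1 : R)%R) => [|A /eqP -> //].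
  rewrite sumr_const -[#|_|]/#|[pred A : {set 'I_d} | #|A| == i]|.
  have -> : #|[pred A : {set 'I_d} | #|A| == i]| = 'C(d, i).
    transitivity 'C(#|'I_d|, i); last by rewrite card_ord.
    by rewrite -card_draws; apply: eq_card => A; rewrite !inE.
  by rewrite -[LHS]mulr_natl mulfV // pnatr_eq0 -lt0n bin_gt0 -ltnS.
rewrite -(pair_bigA _ (fun p (A : {set 'I_d}) => ('C(d, #|A|))%:R^-1 : R))%R /=.
rewrite (eq_bigr (fun=> d.+1%:R)%R) => [|p _]; last exact: e.
by rewrite sumr_const card_prod card_option !card_ord -[LHS]mulr_natl -natrM.
Qed.

(** A Kraft-type count: a word weighs the product of the inverses of its [choices], and all words of
    length [L] weigh [((d.+1 * q.+1) * d.+1) ^ L] together. Codes are padded to length [L] with idle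
    letters at no cost, and a word encodes at most one function. *)
Lemma sum_le_codes v (P : pred {ffun cube d -> 'I_q.+1}) (F : {ffun cube d -> 'I_q.+1} -> R)
    (B : R) (L : nat) : (0 <= B)%R ->
  (forall g, P g -> exists l, [/\ encodes z g v l, (size l <= L)%N &
      F g * (\prod_(x <- l) choices x)%:R <= B])%R ->
  (\sum_(g | P g) F g <= B * ((d.+1 * q.+1) * d.+1)%:R ^+ L)%R.
Proof.
move=> B0 hP.
pose word (f : {ffun 'I_L -> letter d q}) := codom f.
pose wt (f : {ffun 'I_L -> letter d q}) : R := (\prod_i (choices (f i))%:R^-1)%R.
have wt0 f : (0 <= wt f)%R by apply: prodr_ge0 => i _; rewrite invr_ge0.
apply: (@le_trans _ _ (\sum_(g | P g) \sum_(f | encodes z g v (word f)) B * wt f)%R).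
  apply: ler_sum => g /hP[l [lg lL lB]].
  pose l' := l ++ map (@idle d q) (nseq (L - size l) None).
  have sl' : size l' = L by rewrite size_cat size_map size_nseq subnKC.
  pose f := [ffun i : 'I_L => nth (@idle d q None) l' i].
  have wf : word f = l'.
    rewrite /word codomE (eq_map (g := nth (@idle d q None) l' \o val)) => [|i];
      last by rewrite ffunE.
    by rewrite map_comp val_enum_ord -sl' -/(mkseq _ _) mkseq_nth.
  rewrite (bigD1 f) /=; last by rewrite wf encodes_pad.
  rewrite -[leLHS]addr0; apply: lerD; last by apply: sumr_ge0 => h _; rewrite mulr_ge0.
  have -> : wt f = ((\prod_(x <- l) choices x)%:R^-1)%R.
    transitivity ((\prod_(x <- word f) (choices x)%:R^-1)%R : R).
      by rewrite /word codomE big_map big_enum.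
    by rewrite wf prodfV -natr_prod big_cat choices_idle /= muln1.
  rewrite ler_pdivlMr // ltr0n prodn_gt0 // => x.
  by rewrite bin_gt0 -[X in _ <= X]card_ord max_card.
rewrite (exchange_big_dep predT) //= -sum_inv_choices.
have -> : ((\sum_(l : letter d q) (choices l)%:R^-1) ^+ L = \sum_f wt f :> R)%R.
  rewrite -[X in (_ ^+ X)%R]card_ord -prodr_const bigA_distr_bigA //.
rewrite mulr_sumr; apply: ler_sum => f _.
have [/existsP[g /andP[Pg eg]]|/existsPn no] := boolP [exists g, P g && encodes z g v (word f)].
  rewrite (big_pred1 g) // => h; apply/idP/eqP => [/andP[_ eh]|->]; last by rewrite Pg.
  exact: encodes_inj eh eg.
rewrite big_pred0 ?mulr_ge0 // => g; exact: negbTE.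
Qed.

End CodeSum.

(** * The polymer sum *)

(** [n ^ c / c!] is at most ['C(n + c, c)], and ['C(n + c, c) * 8 ^ n] is one term of
    [(8 + 1) ^ (n + c)]. *)
Lemma expn_fact_le n c : n ^ c * 8 ^ n <= 9 ^ (n + c) * c`!.
Proof.
have h1 : n ^ c <= 'C(n + c, c) * c`!.
  rewrite bin_ffact ffact_prod -[X in _ ^ X]card_ord -prod_nat_const.
  by apply: leq_prod => i _; have := ltn_ord i; lia.
have h2 : 'C(n + c, c) * 8 ^ n <= 9 ^ (n + c).
  have cn : c < (n + c).+1 by rewrite ltnS leq_addl.
  rewrite -[9]/(8 + 1) expnDn (bigD1 (Ordinal cn)) //= addnK exp1n muln1.
  by rewrite leq_addr.
by apply: leq_trans (leq_mul h1 (leqnn _)) _; rewrite mulnAC leq_mul2r h2 orbT.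
Qed.

Lemma geometric_tail (R : realFieldType) (x : R) (N n0 : nat) : (0 <= x < 1)%R ->
  (\sum_(n < N | (n0 <= n)%N) x ^+ n <= x ^+ n0 / (1 - x))%R.
Proof.
move=> /andP[x0 x1].
have [N0|N0] := leqP N n0.
  rewrite big_pred0 => [|n]; first by rewrite divr_ge0 ?exprn_ge0 // subr_ge0 ltW.
  by apply/negbTE; rewrite -ltnNge (leq_trans (ltn_ord n)).
rewrite -(big_mkord (fun n => n0 <= n) (fun n => x ^+ n)%R) (big_cat_nat (n := n0)) //= 1?ltnW //.
rewrite big1_seq ?add0r => [|n]; last first.
  by rewrite mem_index_iota => /and3P[h _ h']; move: h; rewrite leqNgt h'.
rewrite big_mkcond /= -[n0 in index_iota n0]add0n big_addn big_mkord.
rewrite (eq_bigr (fun n : 'I__ => x ^+ n0 * x ^+ n)%R) => [|n _]; last first.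
  by rewrite leq_addl exprD mulrC.
rewrite -mulr_sumr ler_wpM2l ?exprn_ge0 //.
rewrite -[leRHS]mul1r ler_pdivlMr ?subr_gt0 //.
have := subrX1 x (N - n0); rewrite -[(x - 1)%R]opprB mulNr => e.
have {e} -> : ((\sum_(i < N - n0) x ^+ i) * (1 - x) = 1 - x ^+ (N - n0))%R.
  by rewrite mulrC -[LHS]opprK -e opprB.
by rewrite lerBlDr lerDl exprn_ge0.
Qed.

Section PolymerSum.
Variables (d q : nat) (z : 'I_q.+1) (R : realFieldType) (k r : nat).
Implicit Types (g : {ffun cube d -> 'I_q.+1}) (v w x y : cube d).
Hypotheses (d_gt1 : 1 < d)
  (expansion : forall C : {set cube d}, #|C| <= k -> 96 * #|C| <= #|nbhd C|)
  (r_gt0 : 0 < r) (r_le : r * r <= d)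
  (D_le : (((d.+1 * q.+1) * d.+1)%:R ^+ 6 <= (16 / 15) ^+ r :> R)%R).

(** A vertex of the neighbourhood is flat only if all its neighbours lie in the support, and
    [card_interior] bounds the number of such vertices. *)
Lemma rough_ge g : #|nbhd (supp z g)| <= rough g + #|supp z g|.
Proof.
apply: leq_trans (leq_add (leqnn _) (card_interior _ (ltnW d_gt1))).
apply: leq_trans (leq_card_setU _ _); apply/subset_leq_card/subsetP => w.
rewrite !inE => /existsP[i]; rewrite inE => gi; apply/orP.
have [/forallP fl|] := boolP (flat g w); [right | by left].
by apply/forallP => j; have /forallP/(_ i) := fl j; rewrite inE => /eqP ->.
Qed.

(** The height at [v] is [z + 2] or [z - 2], since a neighbour of [v] also sees a vertex of height
    [z]; all [d] neighbours of [v] are rough. *)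
Lemma single_polymers v :
  (\sum_(g | polymer z k v g && (#|supp z g| == 1%N)) weight R g <= 2 * 2^-1 ^+ d)%R.
Proof.
have i0 : 'I_d := Ordinal (ltnW d_gt1).
(* Truncated subtraction or an overflowing [inord] only puts a spurious height into [Q], harmless
   for an upper bound. *)
pose Q := [set inord (z + 2); inord (z - 2)] : {set 'I_q.+1}.
apply: (@le_trans _ _ (\sum_(a in Q) 2^-1 ^+ d : R)%R); last first.
  rewrite sumr_const -[leLHS]mulr_natl ler_wpM2r ?exprn_ge0 ?invr_ge0 //.
  by rewrite ler_nat cards2; case: (_ != _).
have sv g : polymer z k v g && (#|supp z g| == 1%N) -> supp z g = [set v].
  move=> /andP[/and4P[_ vS _ _] /cards1P[x e]]; move: vS; rewrite e inE => /eqP -> //.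
apply: (ler_sum_inj (h := fun g => g v)) => [a _|g1 g2 /sv s1 /sv s2 e|g pg].
- by rewrite exprn_ge0 ?invr_ge0.
- apply/ffunP => x; have [->//|xv] := eqVneq x v.
  have o g : supp z g = [set v] -> g x = z.
    by move=> /setP/(_ x); rewrite !inE (negPf xv) => /negbFE/eqP.
  by rewrite !o.
have sg := sv _ pg; have /andP[/and4P[adm vS _ _] _] := pg.
have z_other x : x != v -> g x = z.
  by move=> xv; have /setP/(_ x) := sg; rewrite !inE (negPf xv) => /negbFE/eqP.
pose i1 : 'I_d := Ordinal d_gt1.
have fl (i : 'I_d) : exists j, flip (flip v i) j != v.
  exists (if i == i1 then Ordinal (ltnW d_gt1) else i1).
  apply/eqP => /(congr1 (fun y => flip y i)); rewrite flipC flipK => /flip_dir_inj.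
  by case: (i =P i1) => [-> /(congr1 val)|ii /esym].
split.
  have /forallP/(_ (flip v i1))/forallP/(_ i1) := adm.
  have [j jv] := fl i1; move=> /forallP/(_ j); rewrite flipK (z_other _ jv).
  move: vS; rewrite inE /close_heights -!val_eqE /= => gz.
  rewrite (negPf gz) /= !inE -!val_eqE /= => /orP[]/eqP e.
    by rewrite inordK ?e ?addn2 ?eqxx // -e.
  rewrite [X in _ || (_ == X)]inordK; last by have := ltn_ord z; lia.
  by rewrite e subn2 eqxx orbT.
rewrite /weight ler_wiXn2l ?invr_ge0 // ?invf_le1 ?ler1n //.
rewrite -[X in X <= _]card_ord -(card_codom (@flip_dir_inj d v)).
apply/subset_leq_card/subsetP => _ /codomP[i ->]; rewrite inE.
have [j jv] := fl i; apply/forallP => /(_ i)/forallP/(_ j).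
by rewrite flipK (z_other _ jv); apply/negP; move: vS; rewrite inE.
Qed.

(** [expn_fact_le] gives [P <= 72 ^ c * (9 / 8) ^ n], and [rough_ge] gives weight at most
    [2 ^ c * 2 ^ (- n)]. The product is [144 ^ c * (9 / 16) ^ n]; expansion by 96 absorbs [144 ^ c]
    into [(16 / 15) ^ n], and [16 / 15 * (9 / 16) = 3 / 5]. *)
Lemma choices_bound g (P : nat) : let c := #|supp z g| in let n := #|nbhd (supp z g)| in
  c <= k -> P * c`! <= (8 * n) ^ c ->
  (2^-1 ^+ rough g * P%:R <= (3 / 5) ^+ n :> R)%R.
Proof.
move=> c n ck hP.
have e1 : (2 * 72 = 144 :> R)%R by lra.
have e2 : ((16 / 15) * (2^-1 * (9 / 8)) = 3 / 5 :> R)%R by lra.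
have cn : 96 * c <= n := expansion ck.
have h1 : P * 8 ^ n <= 72 ^ c * 9 ^ n.
  rewrite -(leq_pmul2r (fact_gt0 c)) mulnAC.
  apply: leq_trans (leq_mul hP (leqnn _)) _.
  rewrite expnMn -mulnA; apply: leq_trans (leq_mul (leqnn _) (expn_fact_le n c)) _.
  by rewrite expnD mulnA [9 ^ n * _]mulnC mulnA -expnMn.
have h2 : (144 ^+ c <= (16 / 15) ^+ n :> R)%R.
  apply: (@le_trans _ _ ((16 / 15) ^+ (96 * c))%R); last by apply: ler_weXn2l => //; lra.
  rewrite exprM lerXn2r ?nnegrE //; first by apply: exprn_ge0; lra.
  (* [(16 / 15) ^ 12] exceeds 2, hence [(16 / 15) ^ 96] exceeds [2 ^ 8], which is more than 144. *)
  have -> : ((16 / 15) ^+ 96 = ((16 / 15) ^+ 12) ^+ 8 :> R)%R by rewrite -exprM.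
  apply: (@le_trans _ _ (2 ^+ 8)%R); first by lra.
  by rewrite lerXn2r ?nnegrE //; [apply: exprn_ge0 | ]; lra.
have h3 : (P%:R <= 72 ^+ c * (9 / 8) ^+ n :> R)%R.
  rewrite expr_div_n mulrA ler_pdivlMr ?exprn_gt0 //.
  by rewrite -!natrX -!natrM ler_nat.
have h4 : (2^-1 ^+ rough g <= 2 ^+ c * 2^-1 ^+ n :> R)%R.
  apply: (@le_trans _ _ (2 ^+ c * 2^-1 ^+ (rough g + c))%R).
    by rewrite exprD mulrCA -exprMn divff ?pnatr_eq0 // expr1n mulr1.
  by rewrite ler_wpM2l ?exprn_ge0 // ler_wiXn2l ?invr_ge0 // ?invf_le1 ?ler1n // rough_ge.
apply: le_trans (ler_pM _ _ h4 h3) _; rewrite ?exprn_ge0 ?invr_ge0 ?ler0n //.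
have merge (a b x y : R) : (a ^+ c * x ^+ n * (b ^+ c * y ^+ n) = (a * b) ^+ c * (x * y) ^+ n)%R.
  by rewrite !exprMn mulrACA.
rewrite merge e1 -[X in (_ <= X ^+ _)%R]e2 [X in (_ <= X)%R]exprMn.
by rewrite ler_wpM2r // exprn_ge0 // mulr_ge0 ?divr_ge0 ?invr_ge0.
Qed.

Lemma word_length_le c n m : 96 * c <= n -> m ^ 2 * d <= 16 * n * c ->
  m <= n %/ r.*2.
Proof.
move=> cn hm; rewrite leq_divRL ?double_gt0 // -(@leq_exp2r _ _ 2) //.
rewrite expnMn -[r.*2 ^ 2]/(r.*2 * r.*2) -!mul2n.
have : m ^ 2 * (r * r) <= m ^ 2 * d by rewrite leq_mul2l r_le orbT.
have : n * (96 * c) <= n * n by rewrite leq_mul2l cn orbT.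
rewrite -[n ^ 2]/(n * n); move: hm; move: (m ^ 2) => M; lia.
Qed.

(** Compare [r]-th powers: the exponent is at most [9 * n / 2 + r <= 6 * n], and
    [D ^ 6 <= (16 / 15) ^ r] by hypothesis. With [r] of order [sqrt d], the alphabet, polynomial in
    [d], costs little per neighbour. *)
Lemma words_le n : d <= n ->
  (((d.+1 * q.+1) * d.+1)%:R ^+ (9 * (n %/ r.*2)).+1 <= (16 / 15) ^+ n :> R)%R.
Proof.
move=> dn; set D := (_%:R)%R.
have D1 : (1 <= D)%R by rewrite /D ler1n; lia.
rewrite -(@ler_pXn2r _ r) ?nnegrE //; last 2 first.
- by rewrite exprn_ge0 // (le_trans _ D1).
- by apply: exprn_ge0; lra.
apply: (@le_trans _ _ (D ^+ (6 * n))%R).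
  rewrite -exprM; apply: ler_weXn2l => //.
  have h1 := leq_trunc_div n r.*2.
  have h2 : r <= n by apply: leq_trans dn; apply: leq_trans r_le; rewrite leq_pmulr.
  rewrite mulSn -mulnA; move: h1; rewrite -mul2n; set t := n %/ _ => h1.
  have : 9 * (t * r) <= 5 * n by lia.
  lia.
by rewrite exprM -[leRHS]exprM mulnC [leRHS]exprM lerXn2r ?nnegrE // exprn_ge0 ?divr_ge0 //.
Qed.

(** Polymers are encoded by walks through their greedy cells: [choices_bound] leaves [(3 / 5) ^ n]
    and the words cost [(16 / 15) ^ n]. *)
Lemma polymer_class v n :
  (\sum_(g | polymer z k v g && (#|nbhd (supp z g)| == n)) weight R g <= (16 / 25) ^+ n)%R.
Proof.
have [dn|nd] := leqP d n; last first.
  rewrite big_pred0 ?exprn_ge0 ?divr_ge0 // => g; apply/negP => /andP[/and4P[_ vS _ _] /eqP e].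
  by have := card_nbhd_ge vS; rewrite e leqNgt nd.
have -> : (16 / 25 = (3 / 5) * (16 / 15) :> R)%R by lra.
rewrite exprMn; apply: (le_trans (sum_le_codes (z := z) (v := v) (L :=
  (9 * (n %/ r.*2)).+1) (B := ((3 / 5) ^+ n)%R) _ _)).
- by apply: exprn_ge0; lra.
- move=> g /andP[/and4P[adm vS link ck] /eqP gn].
  have [s [s1 s2 s3 s4]] := greedy_cells (ltnW d_gt1) adm (subxx (supp z g)).
  have [l [l1 l2 l3]] := walk_through_cells link vS s1 s2.
  rewrite gn in s3 s4; exists l; split=> //.
    apply: leq_trans l2 _; rewrite ltnS leq_mul2l /=; apply: word_length_le s4.
    by rewrite -gn expansion.
  rewrite -gn; apply: choices_bound => //; rewrite gn; apply: leq_trans s3.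
  by rewrite leq_mul2r l3 orbT.
by rewrite ler_wpM2l ?words_le //; apply: exprn_ge0; lra.
Qed.

Definition polymer_rate : R := (2 * 2^-1 ^+ d + (16 / 25) ^+ (2 * d - 2) / (1 - 16 / 25))%R.

Lemma polymer_sum_le v : (\sum_(g | polymer z k v g) weight R g <= polymer_rate)%R.
Proof.
rewrite (bigID (fun g => #|supp z g| == 1%N)) /=; apply: lerD; first exact: single_polymers.
pose N := #|cube d|.+1.
have cN (g : {ffun cube d -> 'I_q.+1}) : #|nbhd (supp z g)| < N by rewrite ltnS max_card.
apply: (le_trans _ (geometric_tail N (2 * d - 2) (_ : 0 <= 16 / 25 < 1)%R)); last by apply/andP;
  split; lra.
(* The tail starts at [2 * d - 2] because a larger polymer contains two vertices with at most two
   common neighbours. *)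
rewrite (partition_big (fun g => Ordinal (cN g)) (fun n : 'I_N => 2 * d - 2 <= n)) /=; last first.
  move=> g /andP[/and4P[_ vS _ _] s1].
  have : 1 < #|supp z g|.
    by have : 0 < #|supp z g| by [rewrite card_gt0; apply/set0Pn; exists v]; move: s1;
      case: #|_| => [|[]].
  by move=> /card_gt1P[x [y [xS yS xy]]]; have /= := card_nbhd_ge2 xS yS xy;
    rewrite leq_subLR mul2n -addnn addnC.
apply: ler_sum => n _; apply: le_trans (polymer_class v n).
rewrite [leLHS]big_mkcond [leRHS]big_mkcond; apply: ler_sum => g _ /=.
rewrite -val_eqE /=; case: (polymer _ _ _ _) => //=; case: (_ == n :> nat); rewrite ?andbF //.
by rewrite andbT; case: ifP => // _; exact: weight_ge0.
Qed.

End PolymerSum.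

(** * Fibres over the even vertices *)

Lemma flip_even d (x : cube d) i :
  (flip x i \in even_vertices d) = (x \notin even_vertices d).
Proof.
have o (y : cube d) j : ~~ y j -> odd #|[set l | flip y j l]| = ~~ odd #|[set l | y l]|.
  move=> yj; suff -> : [set l | flip y j l] = j |: [set l | y l].
    by rewrite cardsU1 inE yj oddD.
  apply/setP => l; rewrite !inE ffunE eq_sym.
  by have [<-|] := eqVneq j l; rewrite ?addbF // (negPf yj).
rewrite !inE negbK; have [xi|xi] := boolP (x i); last by rewrite o // negbK.
by have := o (flip x i) i; rewrite flipK ffunE eqxx xi => /(_ isT) ->.
Qed.

Lemma card_odd_vertices d : 0 < d -> #|~: even_vertices d| = 2 ^ d.-1.
Proof.
move=> d_gt0; pose i := Ordinal d_gt0; set E := even_vertices d.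
have e : #|~: E| = #|E|.
  rewrite -(card_imset (mem (~: E)) (@flip_inj d i)); apply: eq_card => x.
  apply/imsetP/idP => [[y yE ->]|xE]; first by rewrite flip_even; rewrite in_setC in yE.
  by exists (flip x i); rewrite ?flipK // in_setC flip_even negbK.
have : #|E| + #|~: E| = 2 ^ d.
  by rewrite cardsC card_ffun card_bool card_ord.
by have -> : 2 ^ d = 2 * 2 ^ d.-1 by [rewrite -expnS prednK]; lia.
Qed.

Lemma card_even_vertices d : 0 < d -> #|even_vertices d| = 2 ^ d.-1.
Proof.
move=> d_gt0; have := cardsC (even_vertices d).
rewrite card_odd_vertices // card_ffun card_bool card_ord.
by have -> : 2 ^ d = 2 * 2 ^ d.-1 by [rewrite -expnS prednK]; lia.
Qed.

Lemma adjacentP d (u v : cube d) : reflect (exists i, v = flip u i) (adjacent u v).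
Proof.
apply: (iffP cards1P) => [[i e]|[i ->]]; exists i.
  apply/ffunP => j; rewrite ffunE; have /setP/(_ j) := e; rewrite !inE.
  by case: (u j) (v j) (j == i) => [] [] [].
by apply/setP => j; rewrite !inE ffunE; case: (u j); case: (j == i).
Qed.

Lemma unit_step_dist d (f : cube d -> int) x y :
  (forall u v, adjacent u v -> `|f u - f v| = 1)%R -> (`|f x - f y| <= d%:Z)%R.
Proof.
move=> fs.
have path_le s : (`|f x - f (foldl (@flip d) x s)| <= (size s)%:Z)%R.
  elim/last_ind: s => [|s i IH]; first by rewrite subrr normr0.
  rewrite foldl_rcons size_rcons; set w := foldl _ _ _ in IH *.
  have : (`|f w - f (flip w i)| = 1)%R by apply: fs; apply/adjacentP; exists i.
  lia.
have -> : y = foldl (@flip d) x (enum [set i | x i != y i]).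
  apply/ffunP => j.
  have H s : uniq s -> foldl (@flip d) x s j = x j (+) (j \in s).
    elim/last_ind: s => [|s i IH]; first by rewrite addbF.
    rewrite rcons_uniq foldl_rcons => /andP[nis /IH]; rewrite ffunE => ->.
    rewrite mem_rcons in_cons; have [->|_] := eqVneq j i; last by rewrite addbF.
    by rewrite (negPf nis) addbF.
  by rewrite H ?enum_uniq // mem_enum inE; case: (x j); case: (y j).
apply: le_trans (path_le _) _.
by rewrite -cardE lez_nat -[X in (_ <= X)%N]card_ord max_card.
Qed.

Lemma unit_neighbour (a b c : nat) : b = c.+1 \/ b.+1 = c -> a = c.+1 \/ a.+1 = c ->
  (c < a) = (c < b) -> a = b.
Proof. by case: (ltnP c a) => ?; case: (ltnP c b) => ?; lia. Qed.

Lemma unit_neighbour2 (a b c e : nat) : c != e -> a = c.+1 \/ a.+1 = c ->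
  a = e.+1 \/ a.+1 = e -> b = c.+1 \/ b.+1 = c -> b = e.+1 \/ b.+1 = e -> a = b.
Proof. lia. Qed.

Section Fibres.
Variables (d q k : nat) (z : 'I_q.+1) (R : realFieldType).
Implicit Types (g h : {ffun cube d -> 'I_q.+1}).

Definition stepped h :=
  [forall x, [forall i, (h x == (h (flip x i)).+1 :> nat) || ((h x).+1 == h (flip x i) :> nat)]].

Lemma steppedP h x i : stepped h ->
  (h x = (h (flip x i)).+1 :> nat) \/ ((h x).+1 = h (flip x i) :> nat).
Proof. by move=> /forallP/(_ x)/forallP/(_ i) /orP[] /eqP; auto. Qed.

Let E := even_vertices d.

Lemma restrict_even_admissible h : stepped h -> admissible (restrict z E h).
Proof.
move=> sh; apply/forallP => w; apply/forallP => i; apply/forallP => j.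
rewrite !ffunE !flip_even; case: ifP => _; rewrite /close_heights ?eqxx //.
by case: (steppedP w i sh); case: (steppedP w j sh); lia.
Qed.

(** At a flat odd vertex the direction up or down fixes the value; at a rough one, two neighbours of
    different heights leave only the height between them. *)
Lemma stepped_inj h1 h2 : stepped h1 -> stepped h2 ->
  restrict z E h1 = restrict z E h2 ->
  (forall w i, w \notin E -> flat (restrict z E h1) w ->
    (h1 (flip w i) < h1 w) = (h2 (flip w i) < h2 w)) -> 0 < d -> h1 = h2.
Proof.
move=> s1 s2 e up d_gt0; apply/ffunP => w.
have eE x : x \in E -> h1 x = h2 x.
  by move=> xE; move/ffunP/(_ x): e; rewrite !ffunE xE.
have [wE|wE] := boolP (w \in E); first exact: eE.
have eN i : h1 (flip w i) = h2 (flip w i) by rewrite eE // flip_even.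
have [fl|] := boolP (flat (restrict z E h1) w).
  pose i := Ordinal d_gt0; have := up w i wE fl; have := steppedP w i s1.
  have := steppedP w i s2; rewrite -eN => a b c; apply/val_inj.
  exact: unit_neighbour a b c.
move=> /forallPn[i] /forallPn[j]; rewrite !ffunE !flip_even wE -val_eqE /= => ij.
have := steppedP w i s1; have := steppedP w i s2; have := steppedP w j s1.
have := steppedP w j s2; rewrite -!eN => a b c e'; apply/val_inj.
exact: unit_neighbour2 ij e' b c a.
Qed.

(** Encode [h] by its even restriction [g] and the set of flat odd vertices where it goes up; for
    fixed [g] there are at most [2 ^ (2 ^ d.-1 - rough g)] such sets. *)
Lemma card_stepped_le : 0 < d ->
  (#|[set h | stepped h && (#|E :&: supp z h| <= k)%N]|%:R <=
   2 ^+ (2 ^ d.-1) * partition_function z R k E)%R.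
Proof.
move=> d_gt0; pose i0 := Ordinal d_gt0.
pose FL g := [set w in ~: E | flat g w].
have FLE g w : (w \in FL g) = (w \notin E) && flat g w by rewrite in_set in_setC.
rewrite -sum1_card natr_sum.
pose Q (p : {ffun cube d -> 'I_q.+1} * {set cube d}) :=
  [&& admissible p.1, supp z p.1 \subset E & (#|supp z p.1| <= k)%N] && (p.2 \subset FL p.1).
apply: (@le_trans _ _ (\sum_(p | Q p) (1 : R))%R).
  apply: (ler_sum_inj (h := fun h => (restrict z E h,
     [set w in FL (restrict z E h) | h (flip w i0) < h w]))) => [p _|h1 h2|h].
  - exact: ler01.
  - rewrite !inE => /andP[s1 _] /andP[s2 _] [e1 e2].
    apply: (stepped_inj s1 s2 e1) => // w i wE fl.
    have eqi h : flat (restrict z E h) w -> h (flip w i) = h (flip w i0).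
      by move=> /forallP/(_ i)/forallP/(_ i0); rewrite !ffunE !flip_even wE => /eqP.
    rewrite !eqi //; last by rewrite -e1.
    by have /setP/(_ w) := e2; rewrite in_set FLE [RHS]in_set FLE -e1 fl wE.
  rewrite inE => /andP[sh hk]; split=> //; rewrite /Q /= restrict_even_admissible //=.
  have -> : supp z (restrict z E h) = E :&: supp z h.
    by apply/setP => x; rewrite in_set ffunE in_setI [x \in supp z h]in_set; case: (x \in E);
      rewrite ?eqxx.
  rewrite subsetIl hk /=; apply/subsetP => w; rewrite inE; by case/andP.
rewrite /Q -(pair_big_dep (fun g => [&& admissible g, supp z g \subset E & (#|supp z g| <= k)%N])
  (fun g (B : {set cube d}) => B \subset FL g) (fun _ _ => 1 : R))%R /=.
rewrite /partition_function mulr_sumr; apply: ler_sum => g /and3P[_ gE _].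
have -> : (\sum_(B : {set cube d} | B \subset FL g) (1 : R) = 2 ^+ #|FL g|)%R.
  rewrite sumr_const -natrX -card_powerset; congr (_ *+ _)%R.
  by apply: eq_card => B; rewrite powersetE.
(* An even vertex is never rough, as its neighbours are odd and have height [z]; flat and rough
   vertices thus partition the odd side. *)
have c : #|FL g| + rough g = 2 ^ d.-1.
  rewrite -card_odd_vertices // -/E -cardsUI.
  have -> : FL g :&: [set w | ~~ flat g w] = set0.
    by apply/setP => w; rewrite !inE; case: (flat g w); rewrite ?andbF.
  rewrite cards0 addn0; apply: eq_card => w; rewrite in_setU FLE in_set in_setC.
  have [wE|//] := boolP (w \in E); last by case: (flat g w).
  apply/negbTE; rewrite negbK; apply/forallP => i; apply/forallP => j.
  have out l : g (flip w l) = z.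
    have : flip w l \notin E by rewrite flip_even wE.
    by apply: contraNeq => gz; apply: (subsetP gE); rewrite inE.
  by rewrite !out.
by rewrite /weight -c exprD -mulrA -exprMn divff ?pnatr_eq0 // expr1n mulr1.
Qed.

End Fibres.

(** * Unlinked sets and the lower bound *)

Lemma sum_subsets (R : realFieldType) (T : finType) (E : {set T}) (y : R) :
  (\sum_(S : {set T} | S \subset E) y ^+ #|S| = (1 + y) ^+ #|E|)%R.
Proof.
have : (\prod_i ((if i \in E then y else 0) + 1) = \sum_(S in {set T}) \prod_i (if i \in S then
  if i \in E then y else 0 else 1))%R.
  exact: bigA_distr.
rewrite (bigID (mem E)) /= (eq_bigr (fun=> (1 + y)%R)) => [|i ->]; last by rewrite addrC.
rewrite [X in (_ * X = _ -> _)%R]big1 => [|i /negPf ->]; last by rewrite add0r.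
rewrite prodr_const mulr1 => ->; rewrite [LHS]big_mkcond [RHS]big_mkcond /=.
apply: eq_bigr => S _; case: ifP => [SE|/negbT/subsetPn[x xS xE]].
  rewrite (bigID (mem S)) /= [X in (_ * X)%R]big1 => [|i /negPf -> //].
  rewrite mulr1 (eq_bigr (fun=> y)) ?prodr_const // => i iS.
  by rewrite iS (subsetP SE).
by rewrite (bigD1 x) //= xS (negPf xE) mul0r.
Qed.

Lemma sum_subsets2 (R : realFieldType) (T : finType) (E : {set T}) (y : R) u v :
  (0 <= y)%R -> u != v ->
  (\sum_(S : {set T} | [&& S \subset E, u \in S & v \in S]) y ^+ #|S| <=
   y ^+ 2 * (1 + y) ^+ #|E|)%R.
Proof.
move=> y0 uv; rewrite -sum_subsets mulr_sumr.
apply: (ler_sum_inj (h := fun S : {set T} => S :\ u :\ v)) => [S _|S1 S2|S].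
- by rewrite mulr_ge0 ?exprn_ge0.
- move=> /and3P[_ u1 v1] /and3P[_ u2 v2] e; apply/setP => x.
  have /setP/(_ x) := e; rewrite !inE.
  have [->|_] := eqVneq x v; first by rewrite v1 v2.
  by have [->|_] := eqVneq x u; first by rewrite u1 u2.
move=> /and3P[SE uS vS]; split.
  by rewrite (subset_trans _ SE) // (subset_trans (subsetDl _ _)) // subsetDl.
by rewrite (cardsD1 u S) uS (cardsD1 v (S :\ u)) !inE vS eq_sym uv -exprD.
Qed.

Definition unlinked d (S : {set cube d}) :=
  [forall x in S, [forall y in S, linked x y ==> (x == y)]].

(** Subtract two classes from the sum over all subsets. If [#|S| > d] then
    [y ^+ #|S| <= 2^-1 ^+ d * (2 * y) ^+ #|S|]; sets with a linked pair are handled by a union bound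
    over at most [#|E| * d ^ 2] pairs, each costing [y ^+ 2 * (1 + y) ^+ #|E|]. *)
Lemma sum_unlinked_ge (R : realFieldType) d (E : {set cube d}) (y : R) : (0 <= y)%R ->
  ((1 + y) ^+ #|E| * (1 - #|E|%:R * d%:R ^+ 2 * y ^+ 2) - 2^-1 ^+ d * (1 + 2 * y) ^+ #|E| <=
   \sum_(S : {set cube d} | [&& S \subset E, unlinked S & (#|S| <= d)%N]) y ^+ #|S|)%R.
Proof.
move=> y0; rewrite lerBlDr mulrBr mulr1 lerBlDr -[in leLHS]sum_subsets.
rewrite (bigID (fun S : {set cube d} => unlinked S && (#|S| <= d)%N)) /= -addrA; apply: lerD => //.
rewrite (bigID (fun S : {set cube d} => (d < #|S|)%N)) /=; apply: lerD.
  rewrite -sum_subsets mulr_sumr [leLHS]big_mkcond [leRHS]big_mkcond; apply: ler_sum => S _.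
  case: ifP => [/andP[/andP[-> _] dS]|_]; last first.
    by case: ifP => // _; rewrite mulr_ge0 ?exprn_ge0 ?mulr_ge0 ?invr_ge0.
  rewrite exprMn mulrA ler_peMl ?exprn_ge0 // -(subnKC (ltnW dS)) exprD mulrA -exprMn.
  by rewrite mulVf ?pnatr_eq0 // expr1n mul1r exprn_ege1 // ler1n.
have -> : ((1 + y) ^+ #|E| * (#|E|%:R * d%:R ^+ 2 * y ^+ 2) =
   \sum_(u in E) \sum_(p : 'I_d * 'I_d) y ^+ 2 * (1 + y) ^+ #|E|)%R.
  rewrite !sumr_const card_prod !card_ord -!mulrnA -[RHS]mulr_natl !natrM.
  by move: ((1 + y) ^+ #|E|)%R (#|E|%:R : R)%R (d%:R : R)%R => a b c; ring.
apply: (@le_trans _ _ (\sum_(u in E) \sum_(p : 'I_d * 'I_d)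
   \sum_(S : {set cube d} | [&& S \subset E, u \in S, flip (flip u p.1) p.2 \in S &
      u != flip (flip u p.1) p.2]) y ^+ #|S|)%R); last first.
  apply: ler_sum => u _; apply: ler_sum => p _.
  have [e|ne] := eqVneq u (flip (flip u p.1) p.2).
    rewrite big_pred0 ?mulr_ge0 ?exprn_ge0 ?addr_ge0 // => S.
    by rewrite !andbF.
  apply: le_trans (sum_subsets2 E y0 ne).
  by rewrite le_eqVlt; apply/orP; left; apply/eqP/eq_bigl => S; rewrite andbT.
have -> : (\sum_(u in E) \sum_(p : 'I_d * 'I_d)
   \sum_(S : {set cube d} | [&& S \subset E, u \in S, flip (flip u p.1) p.2 \in S &
      u != flip (flip u p.1) p.2]) y ^+ #|S| =
   \sum_(S : {set cube d}) \sum_(u in E) \sum_(p : 'I_d * 'I_d)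
     if [&& S \subset E, u \in S, flip (flip u p.1) p.2 \in S &
      u != flip (flip u p.1) p.2] then y ^+ #|S| else 0)%R.
  rewrite [RHS]exchange_big /=; apply: eq_bigr => u _; rewrite [RHS]exchange_big /=.
  by apply: eq_bigr => p _; rewrite big_mkcond.
have ge0 (S : {set cube d}) b : (0 <= if b then y ^+ #|S| else 0 :> R)%R.
  by case: b; rewrite ?exprn_ge0.
rewrite [leLHS]big_mkcond; apply: ler_sum => S _.
case: ifP => [/andP[/andP[SE nsep] dS]|_]; last first.
  by apply: sumr_ge0 => u _; apply: sumr_ge0 => p _.
move: nsep; rewrite leqNgt dS andbT => /forall_inPn[u uS] /forall_inPn[v vS].
rewrite negb_imply => /andP[/existsP[i /existsP[j /eqP ev]] uv].
rewrite (bigD1 u) ?(subsetP SE) //= (bigD1 (i, j)) //= SE uS -ev vS uv /=.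
rewrite -addrA lerDl addr_ge0 //; first by apply: sumr_ge0 => p _.
by apply: sumr_ge0 => w _; apply: sumr_ge0 => p _.
Qed.

Section Profile.
Variable d : nat.
Implicit Types (S T U : {set cube d}) (v : cube d).
Let E := even_vertices d.

(** [S] carries the nonzero even values and [T] those equal to 2; odd neighbours of [S] follow its
    sign, and [U] selects the signs at the other odd vertices. *)
Definition profile S T U : {ffun cube d -> int} :=
  [ffun v => (if v \in E then if v \in S then if v \in T then 2 else - 2 else 0
              else if v \in nbhd S then if v \in nbhd T then 1 else - 1
              else if v \in U then 1 else - 1)%R].

Definition free_vertices S := ~: E :\: nbhd S.

Lemma profile_step S T U u v : S \subset E -> T \subset S -> unlinked S ->
  adjacent u v -> (`|profile S T U u - profile S T U v| = 1)%R.
Proof.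
move=> SE TS un; case/adjacentP => i ->{v}.
wlog uE : u / u \in E => [H|].
  have [/H//|uE] := boolP (u \in E).
  by have := H (flip u i); rewrite flip_even flipK distrC; apply.
rewrite !ffunE flip_even uE /=.
have [uS|uS] := boolP (u \in S); last by case: ifP => _; case: ifP.
rewrite (mem_nbhd i uS).
(* Since [S] is unlinked, [u] is the only vertex of [S] next to [flip u i], so the sign there is
   that of [u]. *)
have -> : (flip u i \in nbhd T) = (u \in T); last by case: (u \in T).
apply/idP/idP => [|uT]; last exact: mem_nbhd.
rewrite inE => /existsP[j jT].
have /forall_inP/(_ u uS)/forall_inP/(_ _ (subsetP TS _ jT))/implyP := un.
have lk : linked u (flip (flip u i) j) by apply/existsP; exists i; apply/existsP; exists j.
by move=> /(_ lk) /eqP ->.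
Qed.

Lemma profile_support S T U : S \subset E ->
  E :\: [set v | profile S T U v == 0%R] = S.
Proof.
move=> SE; apply/setP => v; rewrite in_setD [_ \in [set _ | _]]inE ffunE.
have [vE|vE] := boolP (v \in E); first by case: (v \in S); case: (v \in T).
by rewrite andbF; apply/esym/negbTE; apply: contra vE => /(subsetP SE).
Qed.

Lemma profile_inj S T U S' T' U' : S \subset E -> T \subset S -> U \subset free_vertices S ->
  S' \subset E -> T' \subset S' -> U' \subset free_vertices S' ->
  profile S T U = profile S' T' U' -> [/\ S = S', T = T' & U = U'].
Proof.
move=> SE TS UF SE' TS' UF' e.
have eS : S = S' by rewrite -(profile_support T U SE) e profile_support.
rewrite -{S'}eS in SE' TS' UF' e *.
split=> //; apply/setP => v; move/ffunP/(_ v): e; rewrite !ffunE.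
  have [vS|vS] := boolP (v \in S).
    by rewrite (subsetP SE _ vS); case: (v \in T); case: (v \in T').
  by rewrite (contraNF (subsetP TS v) vS) (contraNF (subsetP TS' v) vS).
have [vF|vF] := boolP (v \in free_vertices S).
  move: vF; rewrite /free_vertices in_setD in_setC => /andP[/negPf -> /negPf ->].
  by case: (v \in U); case: (v \in U').
by rewrite (contraNF (subsetP UF v) vF) (contraNF (subsetP UF' v) vF).
Qed.

Lemma profile_range5 S T U : 0 < d -> S \subset E -> T \subset S -> unlinked S ->
  T != set0 -> T != S -> S != E ->
  forall c, (exists v, profile S T U v = c) <-> c \in [:: -2; -1; 0; 1; 2%:Z]%R.
Proof.
move=> d_gt0 SE TS un T0 TnS SnE c; split=> [[v <-]|].
  by rewrite ffunE; do ![case: ifP => _ //].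
have [x xT] := set0Pn _ T0; have xS := subsetP TS _ xT; have xE := subsetP SE _ xS.
have [y yS yT] : exists2 y, y \in S & y \notin T.
  by apply/subsetPn; apply: contra TnS => ST; rewrite eqEsubset TS.
have [w wE wS] : exists2 w, w \in E & w \notin S.
  by apply/subsetPn; apply: contra SnE => ES; rewrite eqEsubset SE.
have yE := subsetP SE _ yS; pose i := Ordinal d_gt0.
have adj u : adjacent u (flip u i) by apply/adjacentP; exists i.
have fx := profile_step U SE TS un (adj x); have fy := profile_step U SE TS un (adj y).
have ex : profile S T U x = 2%R by rewrite ffunE xE xS xT.
have ey : profile S T U y = (- 2)%R by rewrite ffunE yE yS (negPf yT).
have oneval v : v \notin E -> profile S T U v = 1%R \/ profile S T U v = (-1)%R.
  by move=> vE; rewrite ffunE (negPf vE); do ![case: ifP => _ //]; auto.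
rewrite !in_cons in_nil orbF => /or4P[/eqP ->|/eqP ->|/eqP ->|/orP[/eqP ->|/eqP ->]].
- by exists y.
- exists (flip y i); have := oneval (flip y i); rewrite flip_even yE => /(_ isT) [] // e.
  by move: fy; rewrite ey e.
- by exists w; rewrite ffunE wE (negPf wS).
- exists (flip x i); have := oneval (flip x i); rewrite flip_even xE => /(_ isT) [] // e.
  by move: fx; rewrite ex e.
by exists x.
Qed.

Lemma profile_range4 S (b : bool) U : S \subset E -> S != set0 -> S != E ->
  U \subset free_vertices S -> U != set0 -> U != free_vertices S ->
  forall c, (exists v, profile S (if b then S else set0) U v = c) <->
    c \in [:: -1; 0; 1; if b then 2%:Z else -2]%R.
Proof.
move=> SE S0 SnE UF U0 UnF c; split=> [[v <-]|].
  by rewrite ffunE; case: b; rewrite ?in_set0; case: (v \in S); do ?[case: ifP => // _].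
have [x xS] := set0Pn _ S0; have xE := subsetP SE _ xS.
have [u uU] := set0Pn _ U0; have uF := subsetP UF _ uU.
have [w wE wS] : exists2 w, w \in E & w \notin S.
  by apply/subsetPn; apply: contra SnE => ES; rewrite eqEsubset SE.
have [y yF yU] : exists2 y, y \in free_vertices S & y \notin U.
  by apply/subsetPn; apply: contra UnF => FU; rewrite eqEsubset UF.
rewrite !in_cons in_nil orbF => /or4P[/eqP ->|/eqP ->|/eqP ->|/eqP ->].
- exists y; move: yF; rewrite ffunE in_setD in_setC => /andP[/negPf -> /negPf ->].
  by rewrite (negPf yU).
- by exists w; rewrite ffunE wE (negPf wS).
- exists u; move: uF; rewrite ffunE in_setD in_setC => /andP[/negPf -> /negPf ->].
  by rewrite uU.
by exists x; rewrite ffunE xE xS; case: b; rewrite ?xS ?in_set0.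
Qed.

Variable R : realFieldType.

Lemma card_nbhd_le S : #|nbhd S| <= d * #|S|.
Proof.
rewrite -(sum_nbhd (subxx S)) -sum1_card; apply: leq_sum => w.
rewrite inE => /existsP[i iS]; rewrite card_gt0; apply/set0Pn; exists i; by rewrite inE.
Qed.

Lemma card_free_ge S : 0 < d -> 2 ^ d.-1 <= #|free_vertices S| + d * #|S|.
Proof.
move=> d_gt0; rewrite -card_odd_vertices // -(cardsID (nbhd S) (~: E)) addnC leq_add2l.
apply: leq_trans (card_nbhd_le S); exact: subset_leq_card (subsetIr _ _).
Qed.

Definition good S := [&& S \subset E, unlinked S & #|S| <= d].

Lemma good0 : good set0.
Proof.
rewrite /good sub0set cards0 andbT; apply/forall_inP => x; by rewrite in_set0.
Qed.

Lemma sum_subsets1 (A : {set cube d}) : (\sum_(U : {set cube d} | U \subset A) (1 : R) = 2 ^+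
  #|A|)%R.
Proof. have -> : (2 = 1 + 1 :> R)%R by lra.
by rewrite -sum_subsets; apply: eq_bigr => U _; rewrite expr1n. Qed.

Lemma exp_free_ge S : 0 < d ->
  (2 ^+ (2 ^ d.-1) * (2^-1 ^+ d) ^+ #|S| <= 2 ^+ #|free_vertices S| :> R)%R.
Proof.
move=> d_gt0; rewrite -exprM.
apply: (@le_trans _ _ (2 ^+ (#|free_vertices S| + d * #|S|) * 2^-1 ^+ (d * #|S|))%R).
  by rewrite ler_wpM2r ?exprn_ge0 ?invr_ge0 // ler_weXn2l ?ler1n // card_free_ge.
by rewrite exprD -mulrA -exprMn divff ?pnatr_eq0 // expr1n mulr1.
Qed.

(** The correction term accounts for empty [A], where the two excluded subsets coincide. *)
Lemma proper_subsets_ge (A : {set cube d}) :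
  (2 ^+ #|A| - 2 + (A == set0)%:R <=
   \sum_(U : {set cube d} | [&& U \subset A, U != set0 & U != A]) (1 : R))%R.
Proof.
rewrite -sum_subsets1 (bigD1 set0) ?sub0set //=.
have [->|A0] := eqVneq A set0.
  rewrite big_pred0 => [|U]; last by rewrite subset0; case: (_ == _).
  by apply: le_trans (sumr_ge0 _ _) => //=; rewrite addr0; lra.
rewrite (bigD1 A) ?subxx //= addr0.
have -> : (\sum_(U : {set cube d} | [&& U \subset A, U != set0 & U != A]) (1 : R) =
  \sum_(U : {set cube d} | (U \subset A) && (U != set0) && (U != A)) (1 : R))%R.
  by apply: eq_bigl => U; rewrite andbA.
by move: (bigop _ _ _) => s; lra.
Qed.

Definition profiles5 (p : {set cube d} * ({set cube d} * {set cube d})) :=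
  good p.1 && ([&& p.2.1 \subset p.1, p.2.1 != set0 & p.2.1 != p.1] &&
               (p.2.2 \subset free_vertices p.1)).

Definition profiles4 (p : {set cube d} * (bool * {set cube d})) :=
  (good p.1 && (p.1 != set0)) && [&& p.2.2 \subset free_vertices p.1, p.2.2 != set0 &
     p.2.2 != free_vertices p.1].

(** Each [S] admits [2 ^ #|S| - 2] sets [T], corrected at the empty set, and at least
    [2 ^ (2 ^ d.-1 - d * #|S|)] sets [U]. The three terms tend to [e], [2 * sqrt e] and 1. *)
Lemma card_profiles5 : 0 < d ->
  (2 ^+ (2 ^ d.-1) * (\sum_(S | good S) (2 * 2^-1 ^+ d) ^+ #|S| -
     2 * \sum_(S | good S) (2^-1 ^+ d) ^+ #|S| + 1) <=
   #|[set p | profiles5 p]|%:R :> R)%R.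
Proof.
move=> d_gt0; rewrite -sum1_card natr_sum.
have -> : (\sum_(p in [set p | profiles5 p]) (1%N)%:R =
  \sum_(S | good S) \sum_(T : {set cube d} | [&& T \subset S, T != set0 & T != S])
    \sum_(U : {set cube d} | U \subset free_vertices S) (1 : R))%R.
  under [RHS]eq_bigr => S _ do rewrite pair_big.
  rewrite pair_big_dep; apply: eq_bigl => p; by rewrite inE.
have e1 : (1 = \sum_(S | good S) (S == set0)%:R :> R)%R.
  rewrite (bigD1 set0) ?good0 //= eqxx big1 ?addr0 // => S /andP[_ /negPf ->] //.
rewrite [X in (_ * (_ + X) <= _)%R]e1 mulr_sumr -sumrB -big_split mulr_sumr /=;
  apply: ler_sum => S _.
under [leRHS]eq_bigr => T _ do rewrite sum_subsets1.
rewrite -[X in (_ <= \sum_(_ | _) X)%R]mul1r -mulr_suml.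
have nn : (0 <= 2 ^+ #|S| - 2 + (S == set0)%:R :> R)%R.
  have [->|S0] := eqVneq S set0; first by rewrite cards0 expr0 /=; lra.
  rewrite addr0 subr_ge0 -[leLHS]expr1 ler_weXn2l ?ler1n // card_gt0 //.
apply: le_trans (ler_wpM2r _ (proper_subsets_ge S)); last by rewrite exprn_ge0.
apply: le_trans (ler_wpM2l nn (exp_free_ge S d_gt0)).
have -> : ((2 * 2^-1 ^+ d) ^+ #|S| - 2 * (2^-1 ^+ d) ^+ #|S| + (S == set0)%:R =
   (2 ^+ #|S| - 2 + (S == set0)%:R) * (2^-1 ^+ d) ^+ #|S| :> R)%R.
  rewrite [((2 * _) ^+ _)%R]exprMn; have [->|S0] := eqVneq S set0;
    first by rewrite cards0 !expr0 !mulr1.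
  by rewrite !addr0 mulrBl.
by rewrite mulrCA.
Qed.

(** The common sign on [S] gives the factor 2. At least [d + 1] vertices are free, so the two
    excluded sets [U] cost at most a fraction [2 ^ (- d)]. *)
Lemma card_profiles4 : 0 < d -> d * d + d.+1 <= 2 ^ d.-1 ->
  (2 ^+ (2 ^ d.-1) * (2 * (1 - 2^-1 ^+ d) * (\sum_(S | good S) (2^-1 ^+ d) ^+ #|S| - 1)) <=
   #|[set p | profiles4 p]|%:R :> R)%R.
Proof.
move=> d_gt0 dM; rewrite -sum1_card natr_sum.
have -> : (\sum_(p in [set p | profiles4 p]) (1%N)%:R =
  \sum_(S | good S && (S != set0)) \sum_(b : bool)
    \sum_(U : {set cube d} | [&& U \subset free_vertices S, U != set0 & U != free_vertices S]) (1
      : R))%R.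
  under [RHS]eq_bigr => S _ do rewrite pair_big.
  rewrite pair_big_dep; apply: eq_bigl => p; by rewrite inE.
rewrite (bigD1 set0) ?good0 //= cards0 expr0 addrAC subrr add0r.
rewrite mulrA mulr_sumr; apply: ler_sum => S /andP[/and3P[SE un Sd] S0].
rewrite big_bool /= -mulr2n -[leRHS]mulr_natl -!mulrA [leLHS]mulrCA ler_wpM2l //.
have Fd : d.+1 <= #|free_vertices S|.
  have := card_free_ge S d_gt0; have : d * #|S| <= d * d by rewrite leq_mul2l Sd orbT.
  lia.
apply: le_trans (proper_subsets_ge _).
have -> : (free_vertices S == set0) = false by rewrite -cards_eq0; case: #|_| Fd.
rewrite addr0; apply: (@le_trans _ _ ((1 - 2^-1 ^+ d) * 2 ^+ #|free_vertices S|)%R).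
  rewrite mulrCA ler_wpM2l ?exp_free_ge // subr_ge0 exprn_ile1 ?invr_ge0 // invf_le1 ?ler1n //.
rewrite mulrBl mul1r lerD2l lerN2.
apply: (@le_trans _ _ (2^-1 ^+ d * 2 ^+ d.+1)%R).
  by rewrite exprS mulrCA -exprMn mulVf ?pnatr_eq0 // expr1n mulr1.
by rewrite ler_wpM2l ?exprn_ge0 ?invr_ge0 // ler_weXn2l ?ler1n.
Qed.

End Profile.

From HB Require Import structures.
From mathcomp Require Import finmap.
From mathcomp Require Import all_classical all_reals all_analysis.

Set Implicit Arguments.
Unset Strict Implicit.
Unset Printing Implicit Defensive.

Import Order.TTheory GRing.Theory Num.Theory.
Import numFieldNormedType.Exports.

Local Open Scope classical_set_scope.
Local Open Scope ring_scope.

(** * Asymptotics *)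

Section Asymptotics.
Variable R : realType.

(** With [a = c / (j + 1)], [expR (c * n)] is the power [j + 1] of [expR (a * n) >= a * n], which
    outgrows degree [j]. *)
Lemma poly_le_expR (c C : R) (j : nat) : 0 < c ->
  \forall n \near \oo, C * n.+1%:R ^+ j <= expR (c * n%:R).
Proof.
move=> c0; pose a := c / j.+1%:R; have a0 : 0 < a by rewrite divr_gt0.
have [C0|C0] := leP C 0.
  near=> n; rewrite (le_trans _ (expR_ge0 _)) // mulr_le0_ge0 // exprn_ge0 //.
near=> n.
have n1 : (0 < n)%N by near: n; exact: nbhs_infty_gt.
have n0 : 0 < n%:R :> R by rewrite ltr0n.
apply: (@le_trans _ _ ((a * n%:R) ^+ j.+1)); last first.
  have -> : c * n%:R = j.+1%:R * (a * n%:R).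
    by rewrite mulrA /a mulrCA divff ?mulr1 // pnatr_eq0.
  rewrite [j.+1%:R * _]mulrC expRM_natr lerXn2r ?nnegrE ?expR_ge0 ?mulr_ge0 ?ltW //.
  apply: lt_le_trans (expR_ge1Dx _); lra.
have h : C * 2 ^+ j / a ^+ j.+1 <= n%:R by near: n; exact: nbhs_infty_ger.
move: h; rewrite ler_pdivrMr ?exprn_gt0 // => h.
rewrite exprMn [n%:R ^+ j.+1]exprSr.
apply: (@le_trans _ _ (C * (2 * n%:R) ^+ j)).
  rewrite ler_pM2l // lerXn2r ?nnegrE ?mulr_ge0 // -natrM ler_nat; lia.
have -> : a ^+ j.+1 * (n%:R ^+ j * n%:R) = n%:R * a ^+ j.+1 * n%:R ^+ j.
  by rewrite mulrCA mulrC [_ * n%:R]mulrC.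
by rewrite exprMn mulrA ler_pM2r ?exprn_gt0.
Unshelve. all: by end_near. Qed.

(** Half of the decay rate of [x ^+ d] is kept as [c]; the other half absorbs the polynomial. *)
Lemma exp_small_le (eps : nat -> R) (C x : R) (j : nat) : 0 < x < 1 ->
  (\forall d \near \oo, `|eps d| <= C * d.+1%:R ^+ j * x ^+ d) -> exp_small eps.
Proof.
move=> /andP[x0 x1] He; pose c := - ln x / 2.
have c0 : 0 < c by rewrite divr_gt0 // oppr_gt0 ln_lt0 // x0.
exists c => //; near=> d.
apply: (@le_trans _ _ (C * d.+1%:R ^+ j * x ^+ d)); first by near: d.
apply: (@le_trans _ _ (expR (c * d%:R) * x ^+ d)).
  rewrite ler_wpM2r ?exprn_ge0 1?(ltW x0) //; near: d; exact: poly_le_expR.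
have -> : x ^+ d = expR (- (2 * c) * d%:R).
  by rewrite expRM_natr; congr (_ ^+ _); rewrite /c mulrC divfK ?pnatr_eq0 // opprK lnK // posrE.
rewrite -expRD ler_expR; lra.
Unshelve. all: by end_near. Qed.

Lemma expR_ge_mono (x : R) : 0 <= x <= 1 -> expR x - 1 <= x * expR 1.
Proof.
move=> /andP[x0 x1].
have h := expR_ge1Dx (- x).
have : (1 - x) * expR x <= 1.
  rewrite -[leRHS](expR0 R) -(addNr x) expRD ler_wpM2r ?expR_ge0 //.
have : expR x <= expR 1 by rewrite ler_expR.
move=> h2 h3; have : x * expR x <= x * expR 1 by rewrite ler_wpM2l.
lra.
Qed.

Lemma powerD1_le (M : nat) (y : R) : 0 <= y -> (1 + y) ^+ M <= expR (y * M%:R).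
Proof. by move=> y0; rewrite expRM_natr lerXn2r ?nnegrE ?addr_ge0 ?expR_ge0 ?expR_ge1Dx. Qed.

(** From [y - y ^ 2 <= y / (1 + y) <= ln (1 + y)], followed by [expR (- u) >= 1 - u] for
    [u = y ^ 2 * M]. *)
Lemma powerD1_ge (M : nat) (y : R) : 0 <= y ->
  expR (y * M%:R) * (1 - y * M%:R * y) <= (1 + y) ^+ M.
Proof.
move=> y0; have y1 : 0 < 1 + y by lra.
have h : expR (y - y * y) <= 1 + y.
  apply: (@le_trans _ _ (expR (y / (1 + y)))).
    have y3 : 0 <= y * y * y by rewrite !mulr_ge0.
    by rewrite ler_expR ler_pdivlMr //; lra.
  have := expR_ge1Dx (- (y / (1 + y))); rewrite expRN => h.
  have e : 1 - y / (1 + y) = (1 + y)^-1 by field; lra.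
  by rewrite e in h; rewrite -lef_pV2 ?posrE ?expR_gt0.
apply: (@le_trans _ _ (expR (y - y * y) ^+ M)); last first.
  by rewrite lerXn2r ?nnegrE ?expR_ge0 // ltW.
rewrite -expRM_natr mulrBl expRD ler_wpM2l ?expR_ge0 //.
by rewrite mulrAC; apply: le_trans (expR_ge1Dx _).
Qed.

End Asymptotics.

(** * Transfer between classical sets of integer functions and finite encodings *)

Lemma finite_set_image_sub (I : finType) (T : choiceType) (S : set T) (g : I -> T) (A : {set I}) :
  S `<=` [set x | exists2 a, a \in A & x = g a] ->
  finite_set S /\ (set_card S <= #|A|)%N.
Proof.
move=> SA.
have fS : finite_set S.
  apply: (@sub_finite_set _ _ (g @` [set` A])); last exact/finite_image/finite_finpred.
  by move=> x /SA[a aA ->]; exists a.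
split=> //; rewrite /set_card -(size_image g A); apply: uniq_leq_size; first exact: fset_uniq.
move=> x; rewrite -[x \in _]/(x \in fset_set S) in_fset_set // inE => /SA[a aA ->].
by apply: map_f; rewrite mem_enum.
Qed.

Lemma card_le_set_card (I : finType) (T : choiceType) (S : set T) (h : I -> T) (A : {set I}) :
  finite_set S -> {in A &, injective h} -> (forall a, a \in A -> S (h a)) ->
  (#|A| <= set_card S)%N.
Proof.
move=> fS hI AS; rewrite /set_card -(size_image h A); apply: uniq_leq_size.
  by rewrite map_inj_in_uniq ?enum_uniq // => a b; rewrite !mem_enum; exact: hI.
move=> x /mapP[a]; rewrite mem_enum => aA ->;
  rewrite -[_ \in _]/(h a \in fset_set S) in_fset_set // inE.
exact: AS.
Qed.

Lemma range_size_seq d (f : {ffun cube d -> int}) (l : seq int) : uniq l ->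
  (forall c, (exists v, f v = c) <-> c \in l) -> range_size f = size l.
Proof.
move=> ul hl; apply: perm_size; apply: uniq_perm => //.
move=> c; rewrite -[c \in enum_fset _]/(c \in [fset f v | v : cube d]%fset).
apply/imfsetP/idP => [[v _ ->]|cl]; first by apply/hl; exists v.
by have /hl[v <-] := cl; exists v.
Qed.

Definition centre d : 'I_(2 * d).+1 := inord d.

Definition decode d (h : {ffun cube d -> 'I_(2 * d).+1}) : {ffun cube d -> int} :=
  [ffun v => (h v)%:Z - d%:Z].

(** Fewer than [2 ^ d.-1] even values are nonzero, so some value is 0; the cube has diameter [d],
    hence all values lie between [-d] and [d] and can be shifted by [d]. *)
Lemma F_even_decode (R : realType) (alpha : R) d k : (0 < d)%N ->
  alpha ^+ d <= k%:R -> (k < 2 ^ d.-1)%N ->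
  F_even alpha d `<=` [set f | exists2 h, h \in
    [set h | stepped h && (#|even_vertices d :&: supp (centre d) h| <= k)%N]%SET & f = decode h].
Proof.
move=> d_gt0 ak kM f [fs sm].
have {}sm : (#|even_vertices d :\: zero_set f| < k)%N.
  by rewrite -(@ltr_nat R); exact: lt_le_trans sm ak.
have [v0 v0E v00] : exists2 v, v \in even_vertices d & f v = 0.
  have /subsetPn[v vE] : ~~ (even_vertices d \subset even_vertices d :\: zero_set f).
    apply/negP => /subset_leq_card; rewrite leqNgt card_even_vertices // (ltn_trans sm) //.
  by rewrite finset.in_setD vE andbT inE negbK => /eqP; exists v.
have fb v : `|f v| <= d%:Z by have := unit_step_dist v v0 fs; rewrite v00 subr0.
pose h : {ffun cube d -> 'I_(2 * d).+1} := [ffun v => inord (absz (f v + d%:Z))].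
have hE v : (h v)%:Z = f v + d%:Z.
  by rewrite ffunE inordK; have := fb v; lia.
have hf v : h v = absz (f v + d%:Z) :> nat by rewrite -hE absz_nat.
exists h; last by apply/ffunP => v; rewrite ffunE hE addrK.
rewrite inE; apply/andP; split.
  apply/forallP => x; apply/forallP => i.
  have : Defs.adjacent x (flip x i) by apply/adjacentP; exists i.
  move=> /fs; have := hE x; have := hE (flip x i).
  move: (h x : nat) (h (flip x i) : nat) (f x) (f (flip x i)) => a b y y'; lia.
apply: leq_trans (ltnW sm); apply/subset_leq_card/fintype.subsetP => v /finset.setIP[vE];
  rewrite inE => hv.
rewrite finset.in_setD vE andbT inE; apply: contra hv => /eqP fv; rewrite -val_eqE /= hf fv.
by rewrite inordK // ltnS leq_pmull.
Qed.

(** * The upper bound and the sums over good sets for fixed [d] *)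

Section Bounds.
Variables (R : realType) (d k : nat).
Hypothesis d_gt1 : (1 < d)%N.
Let d_gt0 : (0 < d)%N := ltnW d_gt1.
Let M := (2 ^ d.-1)%N.
Let t : R := 2^-1 ^+ d.

Lemma tM : t * M%:R = 2^-1.
Proof.
rewrite /t /M natrX -[X in _ ^+ X](prednK d_gt0) exprS -mulrA -exprMn.
by rewrite mulVf ?pnatr_eq0 // expr1n mulr1.
Qed.

(** Twice the contribution of the larger polymers after multiplication by [M]; it decays because
    [2 * (16 / 25) ^ 2 = 512 / 625 < 1]. *)
Definition large_rate : R := 25 / 9 * (625 / 256) * (512 / 625) ^+ d.

Lemma polymer_rateM : polymer_rate d R * M%:R = 1 + large_rate / 2.
Proof.
rewrite /polymer_rate -/t mulrDl -[2 * t * _]mulrA tM divff ?pnatr_eq0 //; congr (_ + _).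
have -> : (2 * d - 2 = 2 * d.-1)%N by lia.
have e1 : (1 - 16 / 25)^-1 = 25 / 9 :> R.
  have -> : 1 - 16 / 25 = 9 / 25 :> R by lra.
  by rewrite invf_div.
rewrite e1 /M natrX exprM mulrAC -exprMn /large_rate -[X in (512 / 625) ^+ X](prednK d_gt0) [_ ^+
  d.-1.+1]exprS.
have -> : (16 / 25) ^+ 2 * 2 = 512 / 625 :> R by lra.
by move: ((512 / 625) ^+ d.-1) => X; lra.
Qed.

Lemma F_even_upper (alpha : R) r :
  (forall C : {set cube d}, (#|C| <= k)%N -> (96 * #|C| <= #|nbhd C|)%N) ->
  (0 < r)%N -> (r * r <= d)%N ->
  ((d.+1 * (2 * d).+1) * d.+1)%:R ^+ 6 <= (16 / 15) ^+ r :> R ->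
  alpha ^+ d <= k%:R -> (k < 2 ^ d.-1)%N ->
  finite_set (F_even alpha d) /\
  (set_card (F_even alpha d))%:R <= expR (1 + large_rate / 2) * 2 ^+ M.
Proof.
move=> expansion r_gt0 r_le D_le ak kM.
have [fin le] := finite_set_image_sub (F_even_decode d_gt0 ak kM); split=> //.
apply: (@le_trans _ _ (2 ^+ M * partition_function (centre d) R k (even_vertices d))).
  by apply: le_trans (card_stepped_le k (centre d) R d_gt0); rewrite ler_nat.
rewrite mulrC ler_wpM2r ?exprn_ge0 //.
have rate0 : 0 <= polymer_rate d R.
  by rewrite /polymer_rate addr_ge0 ?mulr_ge0 ?exprn_ge0 ?divr_ge0 ?invr_ge0 //; lra.
have pf : partition_function (centre d) R k (even_vertices d) <=
    (1 + polymer_rate d R) ^+ #|even_vertices d|.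
  apply: partition_function_le => // v _.
  exact: (polymer_sum_le (centre d) d_gt1 expansion r_gt0 r_le D_le).
apply: le_trans pf _.
by rewrite card_even_vertices // -polymer_rateM powerD1_le.
Qed.

Definition good_sum (y : R) := \sum_(S | good S) y ^+ #|(S : {set cube d})|.

Definition sum_error : R := t * (2 * expR 1 * (1 + d%:R ^+ 2) + expR 2).

(** Three losses, all within [sum_error]: the gap between [(1 + y) ^+ M] and [expR x], the linked
    pairs, and the sets with more than [d] elements. *)
Lemma good_sum_ge (y x : R) : 0 <= y -> y <= 2 * t -> y * M%:R = x -> 0 <= x <= 1 ->
  expR x - sum_error <= good_sum y.
Proof.
move=> y0 yt yM /andP[x0 x1].
have := sum_unlinked_ge (even_vertices d) y0; rewrite card_even_vertices // -/M => h.
apply: le_trans h.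
have h1 := powerD1_ge M y0; have h2 := powerD1_le M y0.
have h3 := powerD1_le M (mulr_ge0 (ler0n R 2) y0).
rewrite yM in h1 h2; rewrite -mulrA yM in h3.
have h4 : expR (2 * x) <= expR 2 by rewrite ler_expR; lra.
have h5 : expR x <= expR 1 by rewrite ler_expR.
have t0 : 0 <= t by rewrite exprn_ge0 ?invr_ge0.
have -> : M%:R * d%:R ^+ 2 * y ^+ 2 = x * (d%:R ^+ 2 * y).
  by rewrite -yM; move: (M%:R : R) (d%:R : R) => a b; ring.
set A := (1 + y) ^+ M in h1 h2 *; set B := (1 + 2 * y) ^+ M in h3 *.
have h6 : t * B <= t * expR 2 by rewrite ler_wpM2l // (le_trans h3).
have D0 : 0 <= d%:R ^+ 2 :> R by rewrite exprn_ge0.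
have h7 : A * (x * (d%:R ^+ 2 * y)) <= expR x * (x * (d%:R ^+ 2 * y)).
  by rewrite ler_wpM2r // !mulr_ge0.
have h8 : expR x * (x * (y * (1 + d%:R ^+ 2))) <= expR 1 * (1 * (2 * t * (1 + d%:R ^+ 2))).
  apply: ler_pM; rewrite ?expR_ge0 ?mulr_ge0 ?addr_ge0 //.
  by apply: ler_pM; rewrite ?mulr_ge0 ?addr_ge0 // ler_wpM2r ?addr_ge0.
rewrite /sum_error -/t.
move: h1 h6 h7 h8; clear h2 h3;
  move: A B (d%:R ^+ 2 : R) (expR x) (expR 1) (expR 2) => A B D e e1 e2; lra.
Qed.

Lemma good_sum_le (y : R) : 0 <= y -> good_sum y <= expR (y * M%:R).
Proof.
move=> y0; apply: le_trans (powerD1_le M y0).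
have := sum_subsets (even_vertices d) y; rewrite card_even_vertices // => <-.
rewrite /good_sum [leLHS]big_mkcond [leRHS]big_mkcond; apply: ler_sum => S _.
case gS : (good S); first by case/and3P: gS => ->.
by case: (S \subset even_vertices d) => //; rewrite exprn_ge0.
Qed.

End Bounds.

(** * The lower bounds for ranges of size four and five, for fixed [d] *)

Section LowerBounds.
Variables (R : realType) (alpha : R) (d : nat).
Hypotheses (d_gt1 : (1 < d)%N) (d_alpha : d%:R < alpha ^+ d) (d_M : (d * d + d.+1 <= 2 ^ d.-1)%N)
  (fin : finite_set (F_even alpha d)).
Let d_gt0 : (0 < d)%N := ltnW d_gt1.

Lemma profile_F_even (S T U : {set cube d}) : good S -> T \subset S ->
  F_even alpha d (@profile d S T U).
Proof.
move=> /and3P[SE un Sd] TS; split=> [u v|]; first exact: profile_step.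
by rewrite /small (profile_support T U SE) (le_lt_trans _ d_alpha) // ler_nat.
Qed.

Lemma good_proper (S : {set cube d}) : good S -> S != even_vertices d.
Proof.
move=> /and3P[_ _ Sd]; apply: contraTneq Sd => ->.
by rewrite card_even_vertices // -ltnNge (leq_trans _ d_M) // leq_addl.
Qed.

Lemma F_even_range_finite i : finite_set (F_even_range alpha d i).
Proof. by apply: sub_finite_set fin => f []. Qed.

Lemma F_even_range5_ge :
  (#|[set p | @profiles5 d p]%SET| <= set_card (F_even_range alpha d 5))%N.
Proof.
pose h (p : {set cube d} * ({set cube d} * {set cube d})) := profile p.1 p.2.1 p.2.2.
apply: (@card_le_set_card _ _ _ h).
- exact: F_even_range_finite.
- move=> [S [T U]] [S' [T' U']]; rewrite !inE => /andP[/= gS /andP[/and3P[TS _ _] UF]].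
  move=> /andP[/= gS' /andP[/and3P[TS' _ _] UF']] e.
  have /and3P[SE _ _] := gS; have /and3P[SE' _ _] := gS'.
  by have [-> -> ->] := profile_inj SE TS UF SE' TS' UF' e.
move=> [S [T U]]; rewrite inE => /andP[/= gS /andP[/and3P[TS T0 TnS] UF]].
split; first exact: profile_F_even.
have /and3P[SE un _] := gS.
apply: (range_size_seq (l := [:: -2; -1; 0; 1; 2])) => //.
exact: profile_range5 d_gt0 SE TS un T0 TnS (good_proper gS).
Qed.

Lemma F_even_range4_ge :
  (#|[set p | @profiles4 d p]%SET| <= set_card (F_even_range alpha d 4))%N.
Proof.
have subS (b : bool) (S : {set cube d}) : (if b then S else finset.set0) \subset S.
  by case: b; rewrite ?subxx ?finset.sub0set.
pose h (p : {set cube d} * (bool * {set cube d})) :=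
  profile p.1 (if p.2.1 then p.1 else finset.set0) p.2.2.
apply: (@card_le_set_card _ _ _ h).
- exact: F_even_range_finite.
- move=> [S [b U]] [S' [b' U']]; rewrite !inE => /andP[/= /andP[gS S0] /and3P[UF _ _]].
  move=> /andP[/= /andP[gS' _] /and3P[UF' _ _]] e.
  have /and3P[SE _ _] := gS; have /and3P[SE' _ _] := gS'.
  have [eS eb ->] := profile_inj SE (subS b S) UF SE' (subS b' S') UF' e.
  rewrite -eS in eb *; congr (_, (_, _)).
  by case: b b' eb {e} => [] [] //= eb; move: S0; rewrite -?eb ?eb eqxx.
move=> [S [b U]]; rewrite inE => /andP[/= /andP[gS S0] /and3P[UF U0 UnF]].
split; first exact: profile_F_even.
have /and3P[SE un _] := gS.
apply: (range_size_seq (l := [:: -1; 0; 1; if b then 2 else -2])) => //; first by case: b.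
exact: profile_range4 SE S0 (good_proper gS) UF U0 UnF.
Qed.

Lemma sqrt_expR1 : Num.sqrt (expR 1) = expR (2^-1) :> R.
Proof.
have -> : expR 1 = expR (2^-1) ^+ 2 :> R by rewrite -expRM_natr mulVf ?pnatr_eq0.
by rewrite sqrtr_sqr ger0_norm ?expR_ge0.
Qed.

Let t : R := 2^-1 ^+ d.

Lemma t_ge0 : 0 <= t. Proof. by rewrite exprn_ge0 ?invr_ge0. Qed.

(** At [y = t] the exponent [y * M] equals 1/2, the source of the square root of [e]; at [y = 2 * t]
    it equals 1. *)
Lemma good_sum_half : expR 2^-1 - sum_error R d <= good_sum d t <= expR 2^-1.
Proof.
have e := tM R d_gt1; have t0 := t_ge0.
apply/andP; split; first by apply: (good_sum_ge d_gt1 (x := 2^-1)) => //; rewrite -/t; lra.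
by rewrite -e good_sum_le.
Qed.

Lemma good_sum_one : expR 1 - sum_error R d <= good_sum d (2 * t).
Proof.
have t0 := t_ge0; apply: (good_sum_ge d_gt1) => //; first by lra.
  by rewrite -mulrA tM // divff ?pnatr_eq0.
by lra.
Qed.

Lemma F_even_range5_lower :
  (expR 1 - 2 * Num.sqrt (expR 1) + 1 - sum_error R d) * 2 ^+ (2 ^ d.-1)%N <=
  (set_card (F_even_range alpha d 5))%:R.
Proof.
apply: (@le_trans _ _ (#|[set p | @profiles5 d p]%SET|%:R));
  last by rewrite ler_nat F_even_range5_ge.
apply: le_trans (card_profiles5 R d_gt0); rewrite mulrC ler_wpM2l ?exprn_ge0 //.
rewrite sqrt_expR1 -/(good_sum d (2 * 2^-1 ^+ d)) -/(good_sum d (2^-1 ^+ d)) -/t.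
by have /andP[_ h1] := good_sum_half; have h2 := good_sum_one; lra.
Qed.

Lemma F_even_range4_lower :
  (2 * Num.sqrt (expR 1) - 2 - (2 * sum_error R d + 2 * expR 1 * t)) * 2 ^+ (2 ^ d.-1)%N <=
  (set_card (F_even_range alpha d 4))%:R.
Proof.
apply: (@le_trans _ _ (#|[set p | @profiles4 d p]%SET|%:R));
  last by rewrite ler_nat F_even_range4_ge.
apply: le_trans (card_profiles4 R d_gt0 d_M); rewrite mulrC ler_wpM2l ?exprn_ge0 //.
rewrite sqrt_expR1 -/(good_sum d (2^-1 ^+ d)) -/t.
have /andP[h1 h2] := good_sum_half; have t0 := t_ge0.
have h3 : expR 2^-1 <= expR 1 :> R by rewrite ler_expR; lra.
have h4 : t * (good_sum d t - 1) <= t * expR 1 by rewrite ler_wpM2l //; lra.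
lra.
Qed.

End LowerBounds.

(** * Decay of the error terms and conditions valid for all large [d] *)

Section Eventually.
Variable R : realType.

Lemma ratio_pow_expR (x : R) n : 0 < x -> x ^+ n = expR (ln x * n%:R).
Proof. by move=> x0; rewrite expRM_natr lnK ?posrE. Qed.

Lemma exp_small_expR1D (K x : R) : 0 <= K -> 0 < x < 1 ->
  exp_small (fun d => expR (1 + K * x ^+ d) - expR 1).
Proof.
move=> K0 x01; have /andP[x0 _] := x01.
have X0 d : 0 <= x ^+ d by rewrite exprn_ge0 // ltW.
have [c c0 Hc] : exp_small (fun d => K * x ^+ d).
  apply: (@exp_small_le R _ K x 0) => //; near=> d.
  by rewrite expr0 mulr1 ger0_norm ?mulr_ge0.
apply: (@exp_small_le R _ (expR 1 * (expR 1 * K)) x 0) => //; near=> d.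
have : `|K * x ^+ d| <= expR (- (c * d%:R)) by near: d.
rewrite ger0_norm ?mulr_ge0 // => h.
have le1 : K * x ^+ d <= 1.
  by rewrite (le_trans h) // -[leRHS](expR0 R) ler_expR oppr_le0 mulr_ge0 // ltW.
rewrite expr0 mulr1; have u0 := mulr_ge0 K0 (X0 d).
have h2 : expR (K * x ^+ d) - 1 <= K * x ^+ d * expR 1.
  by apply: expR_ge_mono; rewrite u0.
have a0 : 0 <= expR (K * x ^+ d) - 1 by rewrite subr_ge0 -[leLHS](expR0 R) ler_expR.
rewrite expRD -[X in _ - X]mulr1 -mulrBr normrM (ger0_norm (expR_ge0 _)) (ger0_norm a0).
by rewrite -[leRHS]mulrA ler_wpM2l ?expR_ge0 // (le_trans h2) // mulrC mulrA.
Unshelve. all: by end_near. Qed.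

Lemma large_rate_small : exp_small (fun d => expR (1 + large_rate R d / 2) - expR 1).
Proof.
have e : (fun d => expR (1 + large_rate R d / 2) - expR 1) =
    (fun d => expR (1 + 25 / 9 * (625 / 256) / 2 * (512 / 625) ^+ d) - expR 1).
  by apply/funext => d; rewrite /large_rate mulrAC.
rewrite e; apply: exp_small_expR1D; first by lra.
by apply/andP; split; lra.
Qed.

Lemma sum_error_small (a b : R) : 0 <= a -> 0 <= b ->
  exp_small (fun d => a * sum_error R d + b * 2^-1 ^+ d).
Proof.
move=> a0 b0; have x01 : 0 < (2^-1 : R) < 1 by apply/andP; split; lra.
apply: (@exp_small_le R _ (a * (2 * expR 1 + expR 2) + b) 2^-1 2) => //; near=> d.
have X0 : 0 <= (2^-1 : R) ^+ d by apply: exprn_ge0; lra.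
have e1 := expR_ge0 (1 : R); have e2 := expR_ge0 (2 : R).
rewrite /sum_error ger0_norm; last first.
  by rewrite addr_ge0 ?mulr_ge0 // addr_ge0 ?mulr_ge0 // addr_ge0 ?exprn_ge0.
rewrite [a * _]mulrCA [b * _]mulrC -mulrDr [leRHS]mulrC ler_wpM2l //.
have h1 : 1 <= d.+1%:R ^+ 2 :> R by rewrite exprn_ege1 // ler1n.
have h2 : 1 + d%:R ^+ 2 <= d.+1%:R ^+ 2 :> R.
  by rewrite -!natrX -[1]/(1%:R) -natrD ler_nat -!mulnn; lia.
rewrite [leRHS]mulrDl; apply: lerD; last by rewrite ler_peMr.
rewrite -[leRHS]mulrA ler_wpM2l // [leRHS]mulrDl; apply: lerD; last by rewrite ler_peMr.
by rewrite ler_wpM2l ?mulr_ge0.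
Unshelve. all: by end_near. Qed.

Lemma sqrt_bounds n : exists r, (r * r <= n < r.+1 * r.+1)%N.
Proof.
elim: n => [|n [r /andP[h1 h2]]]; first by exists 0%N.
have [h|h] := ltnP n.+1 (r.+1 * r.+1); first by exists r; apply/andP; split=> //; lia.
by exists r.+1; rewrite h /=; lia.
Qed.

(** [r] is the integer square root of [d]. As [d < (r + 1) ^ 2], the left side is at most
    [64 * (r + 1) ^ 36], which an exponential in [r] dominates. *)
Lemma eventually_radius : \forall d \near \oo, exists r, [/\ (0 < r)%N, (r * r <= d)%N &
  ((d.+1 * (2 * d).+1) * d.+1)%:R ^+ 6 <= (16 / 15) ^+ r :> R].
Proof.
have x0 : (0 < 16 / 15 :> R) by lra.
have c0 : 0 < ln (16 / 15 : R) by rewrite ln_gt0; lra.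
have [N _ HN] := poly_le_expR 64 36 c0.
exists (N.+1 * N.+1)%N => // d /= Nd.
have [r /andP[rd dr]] := sqrt_bounds d.
have Nr : (N < r)%N by rewrite ltnNge; apply/negP => rN; nia.
exists r; split=> //; first by lia.
rewrite (ratio_pow_expR r x0); apply: le_trans (HN r _); last exact: ltnW.
have -> : 64 * r.+1%:R ^+ 36 = (2 * r.+1%:R ^+ 6) ^+ 6 :> R.
  rewrite exprMn -exprM; congr (_ * _); lra.
rewrite lerXn2r ?nnegrE ?mulr_ge0 ?exprn_ge0 //.
rewrite -natrX -natrM ler_nat.
have -> : (r.+1 ^ 6 = (r.+1 * r.+1) * (r.+1 * r.+1) * (r.+1 * r.+1))%N.
  by rewrite !expnS expn0 muln1 !mulnA.
have : (d.+1 * (2 * d).+1 * d.+1 <= 2 * (d.+1 * d.+1 * d.+1))%N by lia.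
move=> /leq_trans; apply; rewrite leq_mul2l /=.
by rewrite leq_mul // leq_mul.
Qed.

Lemma eventually_lt_power (c : R) : 0 < c -> \forall d \near \oo, d%:R < expR c ^+ d.
Proof.
move=> c0; near=> d; rewrite -expRM_natr.
apply: (@lt_le_trans _ _ (1 * d.+1%:R ^+ 1)); first by rewrite mul1r ltr_nat.
by near: d; exact: (poly_le_expR 1 1 c0).
Unshelve. all: by end_near. Qed.

Lemma eventually_square_le : \forall d \near \oo, (d * d + d.+1 <= 2 ^ d.-1)%N.
Proof.
have c0 : 0 < ln 2 :> R by rewrite ln_gt0 // ltr1n.
near=> d.
have d0 : (0 < d)%N by near: d; exact: nbhs_infty_gt.
have : 2 * d.+1%:R ^+ 2 <= expR (ln 2 * d%:R) :> R.
  by near: d; exact: (poly_le_expR 2 2 c0).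
rewrite expRM_natr lnK ?posrE // -!natrX -natrM ler_nat.
have -> : (2 ^ d = 2 * 2 ^ d.-1)%N by rewrite -expnS prednK.
rewrite leq_pmul2l // -mulnn; apply: leq_trans; lia.
Unshelve. all: by end_near. Qed.

Lemma exists_base : exists2 c : R, 0 < c &
  expR c < 2 /\ forall d, expR c ^+ d <= (2 ^ (d %/ 400).+1)%:R.
Proof.
have ln20 : 0 < ln 2 :> R by rewrite ln_gt0 // ltr1n.
have two0 : 0 < 2 :> R by [].
have N1 : (1 < 400)%N by [].
move: N1; move: 400%N => N N1; have N0 : 0 < N%:R :> R by rewrite ltr0n ltnW.
(* The base is [2 ^ (1 / 400)], with [N] standing for 400; the extra [.+1] in the exponent absorbs
   the rounding of [d %/ 400]. *)
exists (ln 2 / N%:R); first exact: divr_gt0.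
split=> [|d].
  rewrite -[X in _ < X](lnK two0) ltr_expR ltr_pdivrMr //.
  by rewrite ltr_pMr // ltr1n.
rewrite natrX -expRM_natr (ratio_pow_expR _ two0) ler_expR -mulrA ler_wpM2l ?(ltW ln20) //.
rewrite mulrC ler_pdivrMr // -natrM ler_nat ltnW // ltn_ceil // ltnW //.
Qed.

End Eventually.

(** [nbhd_expansion] with [K = 96]: since [97 <= 2 ^ 7], the exponent is [m + 8] for [m = d %/ 400],
    and [97 * 2 * (m + 8) < d] once [d >= 4000]. *)
Lemma small_sets_expand d (C : {set cube d}) : (4000 <= d)%N ->
  (#|C| <= 2 ^ (d %/ 400).+1)%N -> (96 * #|C| <= #|nbhd C|)%N.
Proof.
move=> d_big Ck; have := leq_trunc_div d 400; move: (d %/ 400)%N Ck => m Ck md.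
apply: (@nbhd_expansion d (m + 8)); first by lia.
apply: leq_trans (leq_mul (leqnn 97) Ck) _.
by rewrite addnS -addSn expnD mulnC; apply: leq_mul.
Qed.

Theorem theorem2p3 (R : realType) :
  exists2 alpha : R, alpha < 2 &
  exists eps eps4 eps5 : nat -> R,
    [/\ exp_small eps, exp_small eps4 & exp_small eps5] /\
    \forall d \near \oo,
      let M := (2 ^ d.-1)%N in
      let e : R := expR 1 in
      [/\ finite_set (F_even alpha d),
          (set_card (F_even alpha d))%:R <= (e + eps d) * 2 ^+ M,
          (set_card (F_even_range alpha d 4))%:R >=
            (2 * Num.sqrt e - 2 - eps4 d) * 2 ^+ M &
          (set_card (F_even_range alpha d 5))%:R >=
            (e - 2 * Num.sqrt e + 1 - eps5 d) * 2 ^+ M].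
Proof.
have [c c0 [c2 ck]] := exists_base R.
exists (expR c) => //.
exists (fun d => expR (1 + large_rate R d / 2) - expR 1).
exists (fun d => 2 * sum_error R d + 2 * expR 1 * 2^-1 ^+ d).
exists (fun d => sum_error R d).
split.
  split; first exact: large_rate_small.
  - by apply: sum_error_small; rewrite ?mulr_ge0 ?expR_ge0.
  - have := @sum_error_small R 1 0 ler01 (lexx 0).
    by under eq_fun do rewrite mul1r mul0r addr0.
near=> d.
have d_big : (4000 <= d)%N by near: d; exact: nbhs_infty_ge.
have d_gt1 : (1 < d)%N by apply: leq_trans d_big.
have d_lt : d%:R < expR c ^+ d by near: d; exact: eventually_lt_power.
have d_M : (d * d + d.+1 <= 2 ^ d.-1)%N by near: d; exact: (eventually_square_le R).
have [r [r_gt0 r_le D_le]] : exists r, [/\ (0 < r)%N, (r * r <= d)%N &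
  ((d.+1 * (2 * d).+1) * d.+1)%:R ^+ 6 <= (16 / 15) ^+ r :> R].
  by near: d; exact: eventually_radius.
(* The cap [k = 2 ^ (d %/ 400).+1] on supports stays below the number of even vertices, so every
   function counted has an even zero. *)
have kM : (2 ^ (d %/ 400).+1 < 2 ^ d.-1)%N.
  rewrite ltn_exp2l //; have := leq_trunc_div d 400; move: (d %/ 400)%N => m; lia.
have [fin upper] := F_even_upper d_gt1 (fun C => @small_sets_expand d C d_big) r_gt0 r_le D_le
  (ck d) kM.
split=> //.
- by rewrite addrC subrK.
- exact: F_even_range4_lower.
exact: F_even_range5_lower.
Unshelve. all: by end_near. Qed.
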